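(* Let $n\ge 1$. The map $(M,T)\mapsto W$ described in the context is a bijection from the set of pairs $(M,T)$, where $M$ is a rooted planar map with $n$ edges and $T$ is an arbitrary subset of the edges of $M$, onto the set of words $W$ of length $2n$ in the alphabet $\Theta$ with $\overline W=\emptyset$. Moreover, under this bijection (with $T'$, $\tilde T$, $\tilde T'$ and the loops as in the context): (1) the number of edges in $\tilde T$ equals the number of $\mathsf H$'s in $W$; (2) the number of edges in $\tilde T'$ equals the number of $\mathsf C$'s in $W$; (3) the number of loops equals $1$ plus the number of $\mathsf F$'s in $W$; (4) the number of components of $T$ equals $1$ plus the number of $\mathsf F$'s matched to $\mathsf C$'s in $W$; (5) the number of components of $T'$ equals $1$ plus the number of $\mathsf F$'s matched to $\mathsf H$'s in $W$; (6) the number of edges in $T$ equals the number of matches in $W$ of an $\mathsf H$ with an $\mathsf h$ or of a $\mathsf C$ with an $\mathsf F$; (7) the number of edges in $T'$ equals the number of matches in $W$ of a $\mathsf C$ with a $\mathsf c$ or of an $\mathsf H$ with an $\mathsf F$.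
   Context: Words. $\Theta=\{\mathsf C,\mathsf H,\mathsf c,\mathsf h,\mathsf F\}$, where $\mathsf C,\mathsf H$ are burgers and $\mathsf c,\mathsf h,\mathsf F$ are orders. For a finite word $W$ in $\Theta$, the reduced word $\overline W$ is defined inductively: $\overline W=W$ if $W$ has length at most 1; $\overline{W\mathsf C}=\overline W\mathsf C$, $\overline{W\mathsf H}=\overline W\mathsf H$; and $\overline{W\mathsf c}$, $\overline{W\mathsf h}$, $\overline{W\mathsf F}$ are obtained from $\overline W$ by deleting respectively its rightmost $\mathsf C$, its rightmost $\mathsf H$, its rightmost symbol in $\{\mathsf C,\mathsf H\}$ (the deleted burger and the order are then said to be matched), or, if there is no such symbol, by appending the order symbol to the right end of the list of orders in $\overline W$. If $\overline W=\emptyset$ then every symbol of $W$ is matched. Maps. A planar map is a connected planar graph (loops and multiple edges allowed) embedded in the sphere, up to topological deformation; a rooted planar map has a distinguished oriented edge $e$. Let $V$ and $F$ be the sets of vertices and faces of $M$. $M'$ is the dual map. $Q=Q(M)$ is the map with vertex set $V\cup F$ obtained by putting a vertex in each face of $M$ and joining it to all the vertices (with multiplicity) on the boundary of that face; each face of $Q$ is a quadrilateral, one for each edge of $M$, whose two diagonals are that edge and its dual edge. The root of $M$ determines the oriented edge $e_0$ of $Q$ that has the same initial endpoint as $e$ and is the next edge clockwise after $e$ among all edges of $M$ and $Q$ starting at that endpoint. The endpoint of $e_0$ in $V$ is the root and the one in $F$ the dual root. Loops. Given $T$, let $T'$ be the set of dual edges of the edges of $M$ not in $T$. Components of $T$ and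 $T'$ are the connected components of the graphs with vertex sets $V$ and $F$ and edge sets $T$ and $T'$ respectively. $T\cup T'\cup Q$ is a triangulation with $2n$ triangles, each having two sides in $Q$ and one in $T\cup T'$. Passing from triangle to triangle across the edges of $Q$ (never crossing $T\cup T'$) partitions the triangles into loops, such that each edge of $Q$ is crossed exactly once in total. Each loop is also regarded as its set of triangles. Let $L_0$ be the loop crossing $e_0$, oriented and traversed starting from the midpoint of $e_0$, with the $V$-endpoints of the crossed edges on the left and the $F$-endpoints on the right. Construction of $\tilde T,\tilde T'$. View the set $\mathcal T$ of triangles as a graph, two triangles being adjacent if they share an edge, and let $C_1,\dots,C_k$ be the connected components of $\mathcal T\setminus L_0$. For each $j$, let $A_j$ be the last triangle traversed by $L_0$ that shares an edge with a triangle in $C_j$; the shared edge belongs to $T$ or $T'$, and it is replaced by the opposite diagonal of its quadrilateral (an edge by its dual edge or vice versa). This joins one loop of each $C_j$ to $L_0$. Repeat this procedure with the new pair and the new loop through $e_0$ until there is only one loop. The resulting pair $(\tilde T,\tilde T')$ consists of a spanning tree $\tilde T$ of $M$ and a spanning tree $\tilde T'$ of $M'$. The edges of $(\tilde T\setminus T)\cup(\tilde T'\setminus T')$ are called fictional. Construction of $W$. Let $e_0,e_1,\dots,e_{2n}=e_0$ be the edges of $Q$ in the order crossed by the single loop of $(\tilde T,\tilde T')$, started at $e_0$ with $V$-endpoints on the left and $F$-endpoints on the right. Let $d(e_i)=(d_1,d_2)$ where $d_1$ is the distance in $\tilde T$ from the $V$-endpoint of $e_i$ to the root and $d_2$ the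 distance in $\tilde T'$ from the $F$-endpoint of $e_i$ to the dual root. The $i$th letter of the word $\tilde W$ is $\mathsf H$ or $\mathsf C$ if the first or second coordinate, respectively, goes up from $d(e_{i-1})$ to $d(e_i)$, and $\mathsf h$ or $\mathsf c$ if the first or second coordinate, respectively, goes down. Each quadrilateral of $Q$ corresponds to two triangles of $\tilde T\cup\tilde T'\cup Q$, the first traversed corresponding to a burger and the second to an order. $W$ is obtained from $\tilde W$ by replacing by $\mathsf F$ each order letter that corresponds to a triangle with a fictional edge or dual edge.
   Formalization: Items (4) and (5) are false as printed (single non-loop edge, T empty: W = HF but T has 2 components) and are proved with C and H exchanged: components of T = 1 + number of F's matched to H's; components of T' = 1 + number of F's matched to C's. *)

(* Defs.v *)
From HB Require Import structures.
From mathcomp Require Import all_boot fingroup perm.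

Set Implicit Arguments.
Unset Strict Implicit.
Unset Printing Implicit Defensive.

(* bC, bH are the burgers C, H; oc, oh, oF are the orders c, h, F. *)
Variant symbol := bC | bH | oc | oh | oF.

Definition symbol_code (s : symbol) : nat :=
  match s with bC => 0 | bH => 1 | oc => 2 | oh => 3 | oF => 4 end.

Definition symbol_decode (k : nat) : symbol :=
  match k with 0 => bC | 1 => bH | 2 => oc | 3 => oh | _ => oF end.

Lemma symbol_codeK : cancel symbol_code symbol_decode.
Proof. by case. Qed.

HB.instance Definition _ := Equality.copy symbol (can_type symbol_codeK).

Definition is_burger (s : symbol) : bool := (s == bC) || (s == bH).

Definition consumes (o b : symbol) : bool :=
  match o with
  | oc => b == bC
  | oh => b == bH
  | oF => is_burger b
  | _ => false
  end.

Definition del_last (p : pred symbol) (R : seq symbol) : seq symbol :=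
  let r := rev R in rev (take (find p r) r ++ drop (find p r).+1 r).

(* Reduced words consist of orders followed by burgers, so that the two filters
   in the last case split R at the right end of its list of orders. *)
Definition reduce_step (R : seq symbol) (s : symbol) : seq symbol :=
  if is_burger s then rcons R s
  else if has (consumes s) R then del_last (consumes s) R
  else [seq x <- R | ~~ is_burger x] ++ s :: [seq x <- R | is_burger x].

Definition reduce (W : seq symbol) : seq symbol := foldl reduce_step [::] W.

(* The burger that the symbol s deletes when it is appended to a word with
   reduced word R. *)
Definition deleted (R : seq symbol) (s : symbol) : option symbol :=
  ohead [seq b <- rev R | consumes s b].

(* The number of occurrences of o in W that are matched to a burger b. *)
Definition num_matches (b o : symbol) (W : seq symbol) : nat :=
  #|[set i : 'I_(size W) | (nth oF W i == o)
                           && (deleted (reduce (take i W)) o == Some b)]|.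

(* A connected map on an oriented surface is encoded by its darts (oriented
   edges): cw sends a dart to the next dart clockwise around its initial vertex
   and opp reverses it. A dart that follows d along the boundary of the face on
   the right of d starts at the endpoint of d, just counterclockwise of the
   reversal of d. The surface is the sphere when V + F = E + 2. *)
Record rooted_map := RootedMap {
  dart : finType;
  cw : {perm dart};
  opp : {perm dart};
  root : dart;
  opp_involutive : forall d, opp (opp d) = d;
  opp_neq : forall d, opp d != d;
  map_connected :
    forall x y, connect [rel a b | (b == cw a) || (b == opp a)] x y;
  map_euler :
    #|porbits cw| + #|porbits (opp * cw^-1)%g| = #|porbits opp| + 2
}.

Section Maps.
Variable M : rooted_map.
Implicit Types (d x y : dart M) (T : {set {set dart M}}).

Definition fnext : {perm dart M} := (opp M * (cw M)^-1)%g.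

Lemma fnextE d : fnext d = (cw M)^-1%g (opp M d).
Proof. by rewrite permM. Qed.

(* A vertex is the set of darts starting at it, a face the set of darts having
   it on their right, an edge (or its dual edge) the set of its two darts. *)
Definition edge_of d : {set dart M} := porbit (opp M) d.
Definition edges : {set {set dart M}} := porbits (opp M).
Definition num_edges : nat := #|edges|.

(* Adjacency in the graph with edge set T whose vertices are the orbits of p:
   for p = cw M it is a subgraph of M, and for p = fnext a subgraph of the dual
   map (the dual edge of edge_of d joins the faces on both sides of d). *)
Definition adj (p : {perm dart M}) T : rel {set dart M} :=
  fun u v => [exists d, [&& edge_of d \in T, porbit p d == u
                          & porbit p (opp M d) == v]].

Definition num_comps (p : {perm dart M}) T : nat :=
  n_comp (adj p T) (porbits p).

Definition dual_edges T : {set {set dart M}} := edges :\: T.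

(* The edges of Q are the corners of M, indexed by darts: q(d) is the edge of Q
   next clockwise after d, so that e_0 = q(root M). It joins the vertex
   porbit (cw M) d to the face porbit fnext d. The quadrilateral of edge_of d
   has sides q(d), q(fnext d), q(opp d), q(cw^-1 d) in cyclic order.
   Crossing q(d) with its vertex on the left and its face on the right, one
   enters this quadrilateral through a triangle that is also indexed by d:
   - if edge_of d is in T, its third side is this edge, and one leaves it
     through the other side q(fnext d), keeping the same face;
   - otherwise its third side is the dual edge, and one leaves it through the
     other side q(cw^-1 d), keeping the same vertex.
   Thus triangle d has the sides q(d), q(turn T d) in Q and the third side
   edge_of d (or its dual), and the loops are the cycles of turn T. *)
Definition turn T d : dart M :=
  if edge_of d \in T then fnext d else (cw M)^-1%g d.

Definition loop T d : {set dart M} := [set x in orbit (turn T) d].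

Definition num_loops T : nat := #|[set loop T d | d : dart M]|.

Definition share_edge T : rel (dart M) := fun x y =>
  ~~ [disjoint [set x; turn T x] & [set y; turn T y]]
  || (edge_of x == edge_of y).

Definition adj_outside T : rel (dart M) := fun x y =>
  [&& x \notin loop T (root M), y \notin loop T (root M) & share_edge T x y].

Definition outer_comps T : {set {set dart M}} :=
  [set [set y | connect (adj_outside T) x y] | x in ~: loop T (root M)].

(* The sequence orbit (turn T) (root M) lists the triangles of the loop through
   e_0 in the order of traversal. *)
Definition last_contact T (C : {set dart M}) : dart M :=
  last (root M) [seq x <- orbit (turn T) (root M)
                | [exists y in C, share_edge T x y]].

Definition flip_step T : {set {set dart M}} :=
  let X := [set edge_of (last_contact T C) | C in outer_comps T] in
  (T :\: X) :|: (X :\: T).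

(* A step that starts with several loops decreases their number, which is at
   most #|dart M|, and a step that starts with a single loop changes nothing. *)
Definition tilde T : {set {set dart M}} := iter #|dart M| flip_step T.

Definition fictional T d : bool :=
  (edge_of d \in T) != (edge_of d \in tilde T).

End Maps.

(* Graph distance; equal to #|V| if y is not reachable from x. *)
Definition dist (V : finType) (r : rel V) (x y : V) : nat :=
  find (fun k => [exists p : k.-tuple V, path r x p && (last x p == y)])
       (iota 0 #|V|).

Section WordOfMap.
Variables (M : rooted_map) (T : {set {set dart M}}).

Definition vdist (d : dart M) : nat :=
  dist (adj (cw M) (tilde T)) (porbit (cw M) d) (porbit (cw M) (root M)).

Definition fdist (d : dart M) : nat :=
  dist (adj (fnext M) (dual_edges (tilde T)))
       (porbit (fnext M) d) (porbit (fnext M) (root M)).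

(* The letter of the triangle crossed from q(d) to q(turn (tilde T) d);
   exactly one of the two distances changes. *)
Definition tilde_letter (d : dart M) : symbol :=
  let d' := turn (tilde T) d in
  if vdist d < vdist d' then bH
  else if vdist d' < vdist d then oh
  else if fdist d < fdist d' then bC
  else oc.

Definition letter (d : dart M) : symbol :=
  if ~~ is_burger (tilde_letter d) && fictional T d then oF
  else tilde_letter d.

Definition word : seq symbol :=
  mkseq (fun i => letter (iter i (turn (tilde T)) (root M))) (num_edges M).*2.

End WordOfMap.

(* Equality of pairs (M, T) up to topological (orientation-preserving)
   deformation. *)
Definition same_map (M1 : rooted_map) (T1 : {set {set dart M1}})
    (M2 : rooted_map) (T2 : {set {set dart M2}}) : Prop :=
  exists f : dart M1 -> dart M2,
    bijective f
    /\ (forall d, f (cw M1 d) = cw M2 (f d))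
    /\ (forall d, f (opp M1 d) = opp M2 (f d))
    /\ f (root M1) = root M2
    /\ T2 = [set f @: e | e : {set dart M1} in T1].

(* Main.v *)
From mathcomp Require Import all_boot fingroup perm.
From mathcomp Require Import zify.
Require Import Defs.

Set Implicit Arguments.
Unset Strict Implicit.
Unset Printing Implicit Defensive.

(** Let S be the set tilde T and X the set of fictional edges, so that T is the
    symmetric difference of S and X. Once S is known to have a single loop,
    that loop lists all darts in a linear order starting at the root, and every
    edge becomes a chord joining the positions of its two darts. Everything is
    read off from this chord diagram, because crossing or not crossing an edge
    is the same as exchanging its two darts or not: if s is the successor along
    the loop, then the inverse of cw is s after the exchange of the darts of
    the edges of S, fnext is s after the exchange over the dual edges of S, and
    turn T is s after the exchange over X. For any noncrossing set of chords,
    the cycles of s after the exchange are the regions cut out by the chords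
    (eq_porbit_base, card_porbits_noncrossing).

    Planarity makes the diagram noncrossing. Exchanging two points in a
    permutation changes its number of cycles by one, hence a single loop forces
    V <= |S| + 1 and F <= |E - S| + 1, and the Euler relation makes both of
    them equalities. A pair of crossing chords in S, or in E - S, would waste
    two exchanges (noncrossing_of_card, single_noncrossing). The distance of a
    vertex to the root in the tree S is then the number of chords of S that
    surround it (dist_depth), and dually, so that the two darts of an edge
    carry a burger and an order of the same type (letterE).

    The set tilde T is the only S with a single loop for which X is fresh: no
    chord that opens inside a chord of X closes after it. Indeed, if X is fresh
    then flip_step removes precisely the outermost chords of X
    (flip_step_fresh, tilde_unique); and a suitable S exists for every T, by
    induction on the part of the map that the root loop misses, flipping the
    last edge through which the root loop could have left for another loop
    (fresh_tree_exists). Freshness says that the order F at the end of a chord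
    of X meets, as the last burger not yet consumed, the one at the beginning
    of that chord.

    Hence matching the two darts of each edge is a matching of the letters of
    the word in which every order takes the last burger that it may consume.
    Such a matching determines the reduced words of all prefixes
    (reduce_stack_matching), is determined by the word (stack_matching_unique),
    and exists when the word reduces to the empty word (stack_matching_exists).
    So the word gives back the chord diagram with the sets S and X, that is,
    the map and T (word_inj); conversely every such diagram is that of a map
    (chord_map, word_map_exists). The statistics count chords of S or E - S,
    inside or outside X; the loops of T and the components of T and of its dual
    set are counted by regions (card_porbits_noncrossing,
    n_comp_noncrossing). *)

(** * Finite sets, cycles and components *)
Lemma card_imset_same_kernel (T : finType) (U V : finType)
    (f : T -> U) (g : T -> V) :
  (forall x y, (f x == f y) = (g x == g y)) -> #|f @: T| = #|g @: T|.
Proof.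
move=> fg.
pose h u := if [pick x | f x == u] is Some x then Some (g x) else None.
have hf x : h (f x) = Some (g x).
  rewrite /h; case: pickP => [y|/(_ x)]; last by rewrite eqxx.
  by rewrite fg => /eqP->.
rewrite -(card_imset (mem (g @: T)) Some_inj).
rewrite -(_ : h @: (f @: T) = Some @: (g @: T)).
  rewrite card_in_imset // => _ _ /imsetP[x _ ->] /imsetP[y _ ->].
  by rewrite !hf => -[e]; apply/eqP; rewrite fg e.
by rewrite -!imset_comp; apply: eq_imset => x /=; rewrite hf.
Qed.

Lemma porbit_fconnect (D : finType) (s : {perm D}) x y :
  (y \in porbit s x) = fconnect s x y.
Proof.
apply/porbitP/idP => [[i ->]|/iter_findex <-].
  by rewrite permX fconnect_iter.
by exists (findex s x y); rewrite permX.
Qed.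

Lemma porbit_image (D : finType) (s : {perm D}) x : porbit s (s x) = porbit s x.
Proof. by rewrite -(porbit_perm s 1 x) expg1. Qed.

Lemma split_last (T : Type) (p : pred T) (l : seq T) :
  has p l -> exists l1 x l2, [/\ l = l1 ++ x :: l2, p x & ~~ has p l2].
Proof.
elim/last_ind: l => [//|l x IHl]; rewrite has_rcons.
case: (boolP (p x)) => [px _|npx /= /IHl[l1 [y [l2 [-> py npl2]]]]].
  by exists l, x, [::]; rewrite cats1.
exists l1, y, (rcons l2 x); split=> //; first by rewrite rcons_cat.
by rewrite has_rcons negb_or npx.
Qed.

Lemma orbit_of_fcycle (D : finType) (f : D -> D) x (l : seq D) :
  fcycle f (x :: l) -> uniq (x :: l) -> orbit f x = x :: l.
Proof.
by move=> fl ul; rewrite (orbitE fl ul (mem_head _ _)) /= eqxx rot0.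
Qed.

(** Components can be counted through any invariant that separates them. *)
Lemma n_comp_image (V D K : finType) (e : rel V) (g : D -> V) (k : D -> K) :
    symmetric e -> (forall y v, e (g y) v -> v \in g @: D) ->
    (forall y z, connect e (g y) (g z) = (k y == k z)) ->
  n_comp e (g @: D) = #|k @: D|.
Proof.
move=> sym_e clos gk; have csym := sym_connect_sym sym_e.
rewrite -(@card_imset_same_kernel _ _ _ (fun y => fingraph.root e (g y)) k);
  last first.
  by move=> y z; rewrite root_connect // gk.
have clg : closed e (mem (g @: D)).
  by apply: intro_closed => // u v euv /imsetP[y _ eu]; apply: (clos y);
    rewrite -eu.
apply: eq_card => u; rewrite !inE;
  apply/andP/imsetP => [[ru /imsetP[y _ eu]]|[y _ ->]].
  by exists y => //; rewrite -eu; apply/esym/eqP.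
rewrite roots_root //; split=> //.
by rewrite -(closed_connect clg (connect_root e (g y))) imset_f.
Qed.

(** * Exchanging the darts of a set of edges *)
Section Toggle.
Variables (D : finType) (m : {perm D}).
Implicit Types (A B : {set {set D}}) (x y d : D).

(** Edges are the orbits of m. As A is a set of whole orbits, this is a
    permutation whatever A is. *)
Definition toggle A d := if porbit m d \in A then m d else d.

Definition symdiff A B : {set {set D}} := (A :\: B) :|: (B :\: A).

Lemma in_symdiff A B e : (e \in symdiff A B) = ((e \in A) != (e \in B)).
Proof. by rewrite !inE; case: (e \in A); case: (e \in B). Qed.

Lemma symdiffK A B : symdiff A (symdiff A B) = B.
Proof.
by apply/setP=> e; rewrite !in_symdiff; case: (e \in A); case: (e \in B).
Qed.

Lemma porbit_toggle A d : porbit m (toggle A d) = porbit m d.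
Proof. by rewrite /toggle; case: ifP => // _; rewrite porbit_image. Qed.

Lemma toggle_inj A : injective (toggle A).
Proof.
move=> x y exy; move: (exy); rewrite /toggle.
rewrite -(porbit_toggle A x) exy porbit_toggle.
by case: ifP => // _ /perm_inj.
Qed.

Definition toggle_perm A : {perm D} := perm (@toggle_inj A).

Lemma toggle_permE A s d : (toggle_perm A * s)%g d = s (toggle A d).
Proof. by rewrite permM permE. Qed.

Hypothesis mK : forall d, m (m d) = d.

Lemma toggle_symdiff A B d : toggle A (toggle B d) = toggle (symdiff A B) d.
Proof.
rewrite {1 3}/toggle porbit_toggle in_symdiff /toggle.
by case: (_ \in A); case: (_ \in B).
Qed.

Lemma porbit_involution x y :
  (porbit m x == porbit m y) = (x == y) || (x == m y).
Proof.
rewrite eq_porbit_mem; apply/porbitP/orP => [[i ->]|[]/eqP->].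
- elim: i => [|i]; first by rewrite perm1 eqxx; left.
  by rewrite expgSr permM => -[]/eqP->; [right|left; rewrite mK]; rewrite eqxx.
- by exists 0; rewrite perm1.
- by exists 1; rewrite expg1.
Qed.

Lemma toggle_set1 x d :
  toggle [set porbit m x] d = if (d == x) || (d == m x) then m d else d.
Proof. by rewrite /toggle inE porbit_involution. Qed.

Lemma toggle_perm1 x : toggle_perm [set porbit m x] = tperm x (m x).
Proof.
apply/permP=> d; rewrite permE toggle_set1.
by case: tpermP => [->|->|/eqP/negbTE-> /eqP/negbTE->]; rewrite ?mK ?eqxx ?orbT.
Qed.

(** The permutation toggle_perm A is a product of #|A| transpositions, and each
    of them changes the number of cycles by at most one. *)
Lemma card_porbits_toggle A (c : {perm D}) : A \subset porbits m ->
  #|porbits c| <= #|porbits (toggle_perm A * c)%g| + #|A|.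
Proof.
have [n] := ubnP #|A|; elim: n A => // n IHn A le_An sA.
have [->|[e eA]] := set_0Vmem A.
  rewrite cards0 addn0 (_ : toggle_perm set0 = 1%g) ?mul1g //.
  by apply/permP=> d; rewrite permE perm1 /toggle inE.
have /imsetP[x _ ex] := subsetP sA e eA.
have -> : toggle_perm A = (tperm x (m x) * toggle_perm (A :\ e))%g.
  rewrite -toggle_perm1 -ex; apply/permP=> d;
    rewrite permM !permE toggle_symdiff //.
  congr (toggle _ _); apply/setP=> f; rewrite in_symdiff !inE.
  by have [->|_] := eqVneq f e; rewrite ?eA //=; case: (f \in A).
move: le_An; rewrite (cardsD1 e A) eA add1n ltnS => le_An.
have {IHn} := IHn (A :\ e) le_An (subset_trans (subsetDl _ _) sA).
have := porbits_mul_tperm (toggle_perm (A :\ e) * c)%g x (m x).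
rewrite /= mulgA; case: eqVneq => [<-|_];
  rewrite ?porbit_id ?tperm1 ?mul1g addnS.
  by move=> _; apply: leqW.
move: #|porbits (tperm _ _ * _ * _)%g| #|porbits (toggle_perm _ * _)%g|
  #|porbits c|.
by move=> a b k; move: #|_| => l; case: (_ \notin _) => /=; lia.
Qed.

End Toggle.

(** * Chord diagrams on the cycle of a permutation *)
Section Chords.
Variables (D : finType) (m s : {perm D}) (r : D).
Hypothesis mK : forall d, m (m d) = d.
Hypothesis m_neq : forall d, m d != d.
Hypothesis s_single : forall d, d \in porbit s r.
Implicit Types (A B X : {set {set D}}) (x y z d : D).

Definition pos d := findex s r d.

Lemma iter_pos d : iter (pos d) s r = d.
Proof. by apply: iter_findex; rewrite -porbit_fconnect. Qed.

Lemma pos_inj : injective pos.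
Proof. by move=> x y e; rewrite -(iter_pos x) e iter_pos. Qed.

Lemma order_single : fingraph.order s r = #|D|.
Proof. by apply: eq_card => d; rewrite !inE -porbit_fconnect s_single. Qed.

Lemma pos_lt d : pos d < #|D|.
Proof. by rewrite -order_single findex_max // -porbit_fconnect. Qed.

Lemma pos_iter k : k < #|D| -> pos (iter k s r) = k.
Proof. by rewrite -order_single => /findex_iter. Qed.

Lemma card_positions (P : pred nat) n : n = #|D| ->
  #|[set i : 'I_n | P i]| = #|[set d | P (pos d)]|.
Proof.
move=> en; have lt_i (i : 'I_n) : i < #|D| by rewrite -en.
have injf : injective (fun i : 'I_n => iter i s r).
  by move=> i j /(congr1 pos); rewrite !pos_iter // => /val_inj.
rewrite -(card_imset _ injf); apply: eq_card => d; rewrite inE.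
apply/imsetP/idP => [[i]|Pd]; first by rewrite inE => Pi ->; rewrite pos_iter.
have lt_d : pos d < n by rewrite en pos_lt.
by exists (Ordinal lt_d); rewrite ?inE //= iter_pos.
Qed.

Lemma pos_root : pos r = 0.
Proof. exact: findex0. Qed.

Lemma pos_succ d : pos (s d) = if s d == r then 0 else (pos d).+1.
Proof.
case: eqP => [->|nr]; first exact: pos_root.
rewrite -{1}(iter_pos d) -iterS pos_iter // ltn_neqAle pos_lt andbT.
apply/eqP=> e; apply: nr; rewrite -(iter_pos d) -iterS e -order_single.
exact/iter_order/perm_inj.
Qed.

(** The same fact in a form that depends on the size of D only, for comparing
    the positions of two diagrams. *)
Lemma pos_succ_mod d : pos (s d) = (pos d).+1 %% #|D|.
Proof.
have [lt_d|ge_d] := ltnP (pos d).+1 #|D|.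
  by rewrite modn_small // -(pos_iter lt_d) iterS iter_pos.
have e : (pos d).+1 = #|D| by apply/eqP; rewrite eqn_leq pos_lt.
rewrite pos_succ; case: eqP => [_|nr]; first by rewrite e modnn.
by have := pos_lt (s d); rewrite pos_succ; case: eqP => // _; rewrite e ltnn.
Qed.

Lemma pos_pred d : d != r -> exists2 z, s z = d & pos d = (pos z).+1.
Proof.
move=> dr; exists ((s^-1)%g d); first by rewrite permKV.
by rewrite -{1}[d](permKV s) pos_succ permKV (negbTE dr).
Qed.

Lemma pos_eq x y : (pos x == pos y) = (x == y).
Proof. exact: inj_eq pos_inj _ _. Qed.

Lemma closing_pos d : (pos (m d) < pos d) = ~~ (pos d < pos (m d)).
Proof. by rewrite -leqNgt [RHS]leq_eqVlt pos_eq (negbTE (m_neq d)). Qed.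

(** The interval of a chord contains its last point but not its first one,
    being the image under s of the points from x to just before m x: this makes
    it stable under the exchange of x and m x followed by s. *)
Definition within x y := pos x < pos y <= pos (m x).

Definition noncrossing A := forall x y, porbit m x \in A -> porbit m y \in A ->
  pos x < pos y < pos (m x) -> pos x < pos (m y) < pos (m x).

(** Here y is any dart, whether or not its edge is in X. In a word: when the
    order at m x arrives, all burgers produced since x have been consumed. *)
Definition fresh X := forall x y, porbit m x \in X ->
  pos x < pos y < pos (m x) -> pos (m y) < pos (m x).

Lemma fresh_noncrossing X : fresh X -> noncrossing X.
Proof.
move=> frX x y xX yX lt_xy; rewrite (frX x y) // andbT ltnNge.
apply/negP; rewrite leq_eqVlt pos_eq => /orP[/eqP e|lt_yx].
  by move: lt_xy; rewrite -e mK ltnn andbF.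
have := frX (m y) x; rewrite mK porbit_image yX lt_yx => /(_ isT).
by case/andP: lt_xy => -> lt_yx' /(_ isT); rewrite ltnNge ltnW.
Qed.

Lemma sub_noncrossing A B : A \subset B -> noncrossing B -> noncrossing A.
Proof. by move=> /subsetP sAB ncB x y /sAB xB /sAB; apply: ncB. Qed.

Lemma within_succ x y : within x (s y) = (pos x <= pos y < pos (m x)).
Proof.
rewrite /within pos_succ; case: eqP => [e|_] //; rewrite ltn0 /=.
apply/esym/negP => /andP[_ lt_y].
suff: pos y = #|D|.-1 by have := pos_lt (m x); lia.
apply: contraTeq lt_y => ny; apply/negP => lt_y.
have lt_yD : (pos y).+1 < #|D| by have := pos_lt y; lia.
by have := pos_iter lt_yD; rewrite iterS iter_pos e pos_root.
Qed.

Lemma noncrossing_inside A x y : noncrossing A ->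
    porbit m x \in A -> porbit m y \in A -> y != x -> y != m x ->
  (pos x < pos (m y) < pos (m x)) = (pos x < pos y < pos (m x)).
Proof.
move=> ncA xA yA nx nmx; apply/idP/idP; last exact: ncA.
by move/(ncA x (m y)); rewrite mK porbit_image; apply.
Qed.

(** The map s enters the interval from x only and leaves it from m x only. The
    exchange takes each of these two darts to the other one, and any other
    exchanged chord has both ends on the same side. *)
Lemma within_turn A x y : noncrossing A -> porbit m x \in A ->
  within x (s (toggle m A y)) = within x y.
Proof.
move=> ncA xA; rewrite within_succ /within /toggle.
have [->|nx] := eqVneq y x; first by rewrite xA; lia.
have [->|nmx] := eqVneq y (m x); first by rewrite porbit_image xA mK; lia.
have := nx; have := nmx; rewrite -!pos_eq; case: ifP => [yA|_]; last lia.
have := noncrossing_inside ncA xA yA nx nmx.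
have: m y != x by rewrite -[x]mK (inj_eq perm_inj).
have: m y != m x by rewrite (inj_eq perm_inj).
rewrite -!pos_eq; lia.
Qed.

Lemma within_edge A x y : noncrossing A -> porbit m x \in A ->
  porbit m y \in A -> y != x -> y != m x -> within x (m y) = within x y.
Proof.
move=> ncA xA yA nx nmx; have := noncrossing_inside ncA xA yA nx nmx.
have: m y != x by rewrite -[x]mK (inj_eq perm_inj).
have: m y != m x by rewrite (inj_eq perm_inj).
move: nx nmx; rewrite -!pos_eq /within; lia.
Qed.

(** The position just after the opening of the innermost chord of A around y,
    or 0 if there is none. It names the region of the diagram that contains
    y. *)
Definition base A y := \max_(x | (porbit m x \in A) && within x y) (pos x).+1.
Definition base_dart A y := iter (base A y) s r.
Definition depth A y := #|[set x | (porbit m x \in A) && within x y]|.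

Lemma base_le A y : base A y <= pos y.
Proof. by apply/bigmax_leqP => x /andP[_ /andP[]]. Qed.

Lemma pos_base_dart A y : pos (base_dart A y) = base A y.
Proof. exact: pos_iter (leq_ltn_trans (base_le A y) (pos_lt y)). Qed.

Lemma base_dart_eq A y z :
  (base_dart A y == base_dart A z) = (base A y == base A z).
Proof. by rewrite -pos_eq !pos_base_dart. Qed.

Lemma base_root A : base A r = 0.
Proof. by have := base_le A r; rewrite pos_root leqn0 => /eqP. Qed.

Lemma base_ge A x y : porbit m x \in A -> within x y -> pos x < base A y.
Proof.
move=> xA xy; rewrite /base (bigD1 x) ?xA //=; exact: leq_maxl.
Qed.

Variant base_spec A y : nat -> Type :=
| BaseRoot of (forall x, porbit m x \in A -> ~~ within x y) : base_spec A y 0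
| BaseChord x of porbit m x \in A & within x y &
    (forall z, porbit m z \in A -> within z y -> pos z <= pos x) :
    base_spec A y (pos x).+1.

Lemma baseP A y : base_spec A y (base A y).
Proof.
have [x /andP[xA xy]|no] := pickP [pred x | (porbit m x \in A) && within x y].
  have [|z zP e] := @eq_bigmax_cond _
      [pred x | (porbit m x \in A) && within x y] (fun x => (pos x).+1).
    by apply/card_gt0P; exists x; rewrite inE xA.
  have {}e : base A y = (pos z).+1 by rewrite -e.
  have /andP[zA zy] : (porbit m z \in A) && within z y by [].
  rewrite e; constructor=> // t tA ty; rewrite -ltnS -e; exact: base_ge.
rewrite /base big_pred0 //; constructor=> x xA.
by have := no x; rewrite /= xA /= => ->.
Qed.

Lemma base_eq0 A y :
  (base A y == 0) = [forall x, (porbit m x \in A) ==> ~~ within x y].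
Proof.
apply/idP/forallP => [/eqP e x|no]; first by
  apply/implyP=> xA; apply/negP=> xy; have := base_ge xA xy; rewrite e.
by case: baseP => // x xA xy _; have := no x; rewrite xA xy.
Qed.

Lemma base_succ A x : porbit m x \in A -> pos x < pos (m x) ->
  base A (s x) = (pos x).+1.
Proof.
move=> xA opx; have xsx : within x (s x) by rewrite within_succ; lia.
apply/eqP; rewrite eqn_leq base_ge // andbT.
apply: leq_trans (base_le _ _) _; rewrite pos_succ; case: ifP => //.
Qed.

Lemma eq_base A y z :
    (forall x, porbit m x \in A -> within x y = within x z) ->
  base A y = base A z.
Proof.
move=> e; apply: eq_bigl => x; case: (boolP (_ \in A)) => //= xA; exact: e.
Qed.

Lemma eq_depth A y z :
    (forall x, porbit m x \in A -> within x y = within x z) ->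
  depth A y = depth A z.
Proof.
move=> e; apply: eq_card => x; rewrite !inE.
case: (boolP (_ \in A)) => //= xA; exact: e.
Qed.

Definition opens A := [set x | (porbit m x \in A) && (pos x < pos (m x))].

(** Each region is named by the chord that bounds it from outside, except the
    region of the root. *)
Lemma card_base_dart A : #|base_dart A @: D| = (#|opens A|).+1.
Proof.
suff -> : base_dart A @: D = r |: (s @: opens A).
  rewrite cardsU1 card_imset; last exact: perm_inj.
  suff -> : r \notin s @: opens A by [].
  apply/imsetP=> -[x]; rewrite inE => /andP[xA opx] rsx.
  by have := base_succ xA opx; rewrite -rsx base_root.
apply/setP=> d; rewrite !inE;
  apply/imsetP/orP => [[y _ ->]|[/eqP->|/imsetP[x]]].
- rewrite /base_dart; case: baseP => [_|x xA xy _]; [by left|right].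
  rewrite iterS iter_pos imset_f // inE xA; move: xy; rewrite /within; lia.
- by exists r; rewrite // /base_dart base_root.
- rewrite inE => /andP[xA opx] ->; exists (s x) => //.
  by rewrite /base_dart base_succ // iterS iter_pos.
Qed.

Section Noncrossing.
Variable A : {set {set D}}.
Hypothesis ncA : noncrossing A.

Let q : {perm D} := (toggle_perm m A * s)%g.

Lemma base_turn y : base A (s (toggle m A y)) = base A y.
Proof. by apply: eq_base => x xA; rewrite within_turn. Qed.

Lemma depth_turn y : depth A (s (toggle m A y)) = depth A y.
Proof. by apply: eq_depth => x xA; rewrite within_turn. Qed.

Lemma porbit_within x y z : porbit m x \in A -> y \in porbit q z ->
  within x y = within x z.
Proof.
move=> xA; rewrite porbit_fconnect => /iter_findex <-.
by elim: (findex _ _ _) => //= i <-; rewrite toggle_permE within_turn.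
Qed.

(** Go back from y one step at a time, jumping over the chords that close
    there: this stays in the cycle and in the region, and it can only stop at
    the first dart of the region. *)
Lemma porbit_base_dart y : base_dart A y \in porbit q y.
Proof.
rewrite porbit_sym; have [n] := ubnP (pos y); elim: n y => // n IHn y le_yn.
have step z : s (toggle m A z) = y -> pos z < pos y ->
    y \in porbit q (base_dart A y).
  move=> e lt_z; rewrite -eq_porbit_mem -e -toggle_permE porbit_image
    eq_porbit_mem.
  rewrite /base_dart toggle_permE base_turn; apply: IHn.
  exact: leq_trans lt_z _.
have [e|ne] := eqVneq (base A y) (pos y).
  by rewrite /base_dart e iter_pos porbit_id.
have ny : y != r by apply: contraNneq ne => ->; rewrite base_root pos_root.
have [z szy posy] := pos_pred ny.
have [zA|nzA] := boolP (porbit m z \in A); last first.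
  by apply: (step z); rewrite ?posy // /toggle (negbTE nzA).
have [opz|clz] := ltnP (pos z) (pos (m z)).
  by rewrite -szy base_succ // szy posy eqxx in ne.
apply: (step (m z)); first by rewrite /toggle porbit_image zA mK.
by rewrite posy ltnS.
Qed.

(** The cycles are the regions of the diagram. *)
Lemma eq_porbit_base y z :
  (porbit q y == porbit q z) = (base_dart A y == base_dart A z).
Proof.
apply/idP/eqP => [|e].
  rewrite eq_porbit_mem => yz; apply/eqP; rewrite base_dart_eq.
  by apply/eqP/eq_base => x xA; apply: porbit_within.
rewrite eq_porbit_mem; apply/porbitP.
have: base_dart A y \in porbit q z by rewrite e porbit_base_dart.
rewrite -eq_porbit_mem => /eqP yz.
have := porbit_base_dart y; rewrite porbit_sym => yy.
by apply/porbitP; rewrite -yz.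
Qed.

Lemma card_porbits_noncrossing : #|porbits q| = (#|opens A|).+1.
Proof.
by rewrite -card_base_dart; apply: card_imset_same_kernel eq_porbit_base.
Qed.

Lemma in_root_porbit y :
  (y \in porbit q r) = [forall x, (porbit m x \in A) ==> ~~ within x y].
Proof.
by rewrite -eq_porbit_mem eq_porbit_base base_dart_eq base_root base_eq0.
Qed.

Lemma outermost y : y \notin porbit q r ->
  exists i, [/\ i \in porbit q r, porbit m i \in A & within i y].
Proof.
rewrite in_root_porbit negb_forall => /existsP[x];
  rewrite negb_imply negbK => xP.
have /= [i /andP[iA iy] imin] :=
  @arg_minnP _ x (fun x => (porbit m x \in A) && within x y) pos xP.
exists i; split=> //; rewrite in_root_porbit; apply/forallP=> z;
  apply/implyP=> zA.
apply/negP=> zi; have nmi : i != m z.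
  by apply/eqP=> e; move: zi iy; rewrite /within e mK; lia.
have nzi : i != z by apply/eqP=> e; move: zi; rewrite /within e; lia.
have := within_edge ncA zA iA nzi nmi; rewrite zi => zmi.
have zy : within z y by move: zi zmi iy; rewrite /within; lia.
have := imin z; rewrite zA zy => /(_ isT); move: zi; rewrite /within; lia.
Qed.

Lemma close_notin_root_porbit x : porbit m x \in A -> pos x < pos (m x) ->
  m x \notin porbit q r.
Proof.
move=> xA opx; rewrite in_root_porbit negb_forall; apply/existsP; exists x.
by rewrite xA negbK /within opx leqnn.
Qed.

(** The cycle of the root jumps over every chord that it meets, so it moves
    forward until it is back at the root. *)
Lemma sorted_orbit : sorted (fun y z => pos y < pos z) (orbit q r).
Proof.
have pth n z : z \in porbit q r ->
    (forall k, k < n -> iter k q (q z) != r) ->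
    path (fun y z => pos y < pos z) z (traject q (q z) n).
  elim: n z => //= n IHn z zr nr; rewrite IHn ?porbit_image.
  - rewrite andbT toggle_permE pos_succ.
    have := nr 0 isT; rewrite /= toggle_permE => /negbTE->.
    rewrite /toggle ltnS; case: ifP => // zA.
    rewrite leqNgt; apply/negP => clz.
    have := @close_notin_root_porbit (m z).
    by rewrite porbit_image mK zA clz zr => /(_ isT isT).
  - by rewrite -eq_porbit_mem porbit_image eq_porbit_mem.
  - by move=> k lt_kn; rewrite -iterSr nr.
rewrite /orbit -orderSpred /= pth ?porbit_id // => k lt_k.
apply/eqP; rewrite -iterSr => e.
have := @findex_iter _ q r k.+1; rewrite e findex0 -orderSpred ltnS.
by move=> /(_ lt_k).
Qed.

End Noncrossing.

(** Vertices are the cycles of p, assumed to be the regions cut out by A; the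
    set A is then a tree on these vertices, in which the parent of a region is
    the region on the other side of its bounding chord. *)
Section Tree.
Variables (A : {set {set D}}) (p : {perm D}).
Hypothesis ncA : noncrossing A.
Hypothesis pE : forall y, porbit p y = porbit (toggle_perm m A * s)%g y.

(** Convertible to adj when m reverses the darts of a rooted map. *)
Definition edge_adj (T : {set {set D}}) : rel {set D} := fun u v =>
  [exists d, [&& porbit m d \in T, porbit p d == u & porbit p (m d) == v]].

Lemma edge_adj_sym T : symmetric (edge_adj T).
Proof.
suff sub u v : edge_adj T u v -> edge_adj T v u.
  by move=> u v; apply/idP/idP; apply: sub.
move=> /existsP[d /and3P[dT du dv]]; apply/existsP; exists (m d).
by rewrite porbit_image mK dT du dv.
Qed.

Lemma edge_adjI (T : {set {set D}}) d : porbit m d \in T ->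
  edge_adj T (porbit p d) (porbit p (m d)).
Proof. by move=> dT; apply/existsP; exists d; rewrite dT !eqxx. Qed.

Lemma eq_vertex_depth y z : porbit p y = porbit p z -> depth A y = depth A z.
Proof.
rewrite !pE => /eqP; rewrite eq_porbit_mem => yz; apply: eq_depth => x xA.
exact: (porbit_within ncA xA yz).
Qed.

Lemma vertex_turn y : porbit p (s (toggle m A y)) = porbit p y.
Proof. by rewrite !pE -toggle_permE porbit_image. Qed.

Lemma vertex_base_dart y : porbit p y = porbit p (base_dart A y).
Proof. by apply/esym/eqP; rewrite !pE eq_porbit_mem porbit_base_dart. Qed.

Lemma depth_edge d : porbit m d \in A -> pos d < pos (m d) ->
  depth A (m d) = (depth A d).+1.
Proof.
move=> dA opd; rewrite /depth (cardsD1 d) inE dA /within opd leqnn /= add1n.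
congr _.+1; apply: eq_card => x; rewrite !inE.
have [->|nx] := eqVneq x d; first by rewrite ltnn andbF.
case: (boolP (_ \in A)) => //= xA; have [->|nmx] := eqVneq x (m d).
  by rewrite /within mK; lia.
have nmx' : d != m x by apply: contraNneq nmx => ->; rewrite mK.
apply: (within_edge ncA) => //; by rewrite eq_sym.
Qed.

(** The depth is a function of the vertex that changes by one along each edge
    of A. *)
Lemma depth_path y u l : u = porbit p y -> path (edge_adj A) u l ->
  last u l = porbit p r -> depth A y <= size l.
Proof.
elim: l y u => [|v l IHl] y u eu /=.
  move=> _; rewrite eu => /eq_vertex_depth->.
  rewrite leqn0 cards_eq0; apply/eqP/setP=> x; rewrite !inE.
  by rewrite /within pos_root andbF.
case/andP=> /existsP[d /and3P[dA /eqP du /eqP dv]] pl ll.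
apply: leq_trans (_ : (depth A (m d)).+1 <= _); last first.
  by rewrite ltnS (IHl _ v).
rewrite (@eq_vertex_depth y d) -1?eu -1?du //.
case: (ltngtP (pos d) (pos (m d))) => [opd|cld|/pos_inj e].
- by rewrite depth_edge // leqW.
- by have := @depth_edge (m d); rewrite porbit_image mK => /(_ dA cld) ->.
- by have := m_neq d; rewrite -e eqxx.
Qed.

(** The innermost chord around y leads to the parent, one level up. *)
Lemma path_of_depth n y : depth A y = n ->
  exists l, [/\ size l = n, path (edge_adj A) (porbit p y) l
             & last (porbit p y) l = porbit p r].
Proof.
elim: n y => [|n IHn] y dy; have := vertex_base_dart y; rewrite /base_dart.
  case: baseP => [_|x xA xy _] yv; first by exists [::]; rewrite /= yv.
  suff: x \in set0 by rewrite inE.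
  by move/eqP: dy; rewrite cards_eq0 => /eqP <-; rewrite inE xA.
case: baseP => [no|x xA xy _]; rewrite ?iterS ?iter_pos => yv.
  suff: depth A y == 0 by rewrite dy.
  rewrite cards_eq0; apply/eqP/setP=> x; rewrite !inE; apply/negP=> /andP[xA].
  exact/negP/no.
have opx : pos x < pos (m x) by move: xy; rewrite /within; lia.
have yv' : porbit p y = porbit p (m x).
  by rewrite yv -(vertex_turn (m x)) /toggle porbit_image xA mK.
have [|l [sl pl ll]] := IHn x.
  by have := depth_edge xA opx; rewrite -(eq_vertex_depth yv') dy => -[].
exists (porbit p x :: l); rewrite /= sl pl andbT yv'; split=> //.
by rewrite edge_adj_sym edge_adjI.
Qed.

Lemma dist_depth y : dist (edge_adj A) (porbit p y) (porbit p r) = depth A y.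
Proof.
rewrite /dist; set P := (fun k => _).
have Pd : P (depth A y).
  have [l [sl pl ll]] := path_of_depth (erefl (depth A y)).
  by apply/existsP; exists (tcast sl (in_tuple l));
    rewrite val_tcast /= pl ll eqxx.
(* dist searches up to the number of all sets of darts, which is 2 ^ #|D| *)
have lt_d : depth A y < #|{: {set D}}|.
  rewrite -cardsT -powersetT card_powerset cardsT.
  by apply: leq_ltn_trans (max_card _) (ltn_expl _ _).
have hP : has P (iota 0 #|{: {set D}}|).
  by apply/hasP; exists (depth A y) => //; rewrite mem_iota add0n.
have := nth_find 0 hP; set k := find _ _; rewrite nth_iota; last first.
  by rewrite -[X in _ < X](size_iota 0) -has_find.
rewrite add0n => /existsP[l /andP[pl /eqP ll]].
apply/eqP; rewrite eqn_leq.
rewrite (leq_trans (depth_path (erefl _) pl ll)) ?size_tuple //.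
rewrite andbT leqNgt; apply/negP => lt_dk.
by have := before_find 0 lt_dk; rewrite nth_iota // add0n Pd.
Qed.

(** Removing the chords of R from the tree A leaves one component for each of
    them and one for the root. The chords of X outside A are added to the edge
    set, but they cross no chord of R and hence join no two components. So the
    components are the regions cut out by R. *)
Section Components.
Variable X : {set {set D}}.
Hypothesis frX : fresh X.
Let T := symdiff A X.
Let R := A :&: X.

Let ncX := fresh_noncrossing frX.

Let base_edge d : porbit m d \in T -> base R (m d) = base R d.
Proof.
move=> dT; apply: eq_base => x; rewrite inE => /andP[xA xX].
have nx d' : porbit m d' \in T -> x != d'.
  by rewrite in_symdiff; apply: contraTneq => <-; rewrite xA xX.
have nd : d != x by rewrite eq_sym nx.
have nmd : d != m x.
  by apply: contraTneq (nx (m d) _) => [->|]; rewrite ?mK ?eqxx // porbit_image.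
move: dT; rewrite in_symdiff; case: (boolP (porbit m d \in A)) => dA.
  by move=> _; apply: (within_edge ncA).
by case: (boolP (porbit m d \in X)) => // dX _; apply: (within_edge ncX).
Qed.

Let base_vertex y z : porbit p y = porbit p z -> base R y = base R z.
Proof.
rewrite !pE => /eqP; rewrite eq_porbit_mem => yz; apply: eq_base => x.
by rewrite inE => /andP[xA _]; apply: (porbit_within ncA xA yz).
Qed.

Let connect_base y z :
  connect (edge_adj T) (porbit p y) (porbit p z) -> base R y = base R z.
Proof.
case/connectP=> l; elim: l y => [|v l IHl] y /= => [_ /base_vertex -> //|].
case/andP=> /existsP[d /and3P[dT /eqP du /eqP dv]].
by rewrite -dv => pl /(IHl _ pl) <-; rewrite (base_edge dT); apply: base_vertex.
Qed.

(** Move to the parent in the tree A as long as the chord crossed is not in X,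
    that is, as long as it is still in T. *)
Let base_connect y :
  connect (edge_adj T) (porbit p y) (porbit p (base_dart R y)).
Proof.
have [n] := ubnP (pos y); elim: n y => // n IHn y le_yn.
have := vertex_base_dart y; rewrite /base_dart.
case: baseP => [no|x xA xy xmax] yv.
  rewrite yv (_ : base R y = 0) ?connect0 //; apply/eqP; rewrite base_eq0.
  apply/forallP=> x; apply/implyP; rewrite inE => /andP[xA _]; exact: no.
rewrite iterS iter_pos in yv.
have opx : pos x < pos (m x) by move: xy; rewrite /within; lia.
have [xX|nxX] := boolP (porbit m x \in X).
  suff -> : base R y = (pos x).+1 by rewrite iterS iter_pos yv connect0.
  have xR : porbit m x \in R by rewrite inE xA.
  by rewrite (base_vertex yv) base_succ.
have xT : porbit m x \in T by rewrite in_symdiff xA nxX.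
have yv' : porbit p y = porbit p (m x).
  by rewrite yv -(vertex_turn (m x)) /toggle porbit_image xA mK.
rewrite (base_vertex yv') base_edge //.
apply: connect_trans (IHn x _); last by move: xy; rewrite /within; lia.
by rewrite yv' connect1 // edge_adj_sym edge_adjI.
Qed.

Lemma n_comp_noncrossing :
  n_comp (edge_adj T) (porbits p) = (#|opens (A :&: X)|).+1.
Proof.
rewrite -card_base_dart; apply: n_comp_image.
- exact: edge_adj_sym.
- by move=> y v /existsP[d /and3P[_ _ /eqP <-]]; rewrite imset_f.
have csym := sym_connect_sym (@edge_adj_sym T).
move=> y z; apply/idP/eqP => [/connect_base|] e.
  by apply/eqP; rewrite base_dart_eq e.
apply: connect_trans (base_connect y) _; rewrite -/R e csym;
  exact: base_connect.
Qed.

End Components.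
End Tree.

Section Counting.
Variable A : {set {set D}}.
Hypothesis sA : A \subset porbits m.

Lemma card_opens : #|opens A| = #|A|.
Proof.
rewrite -(@card_in_imset _ _ (porbit m) (opens A)).
  apply: eq_card => e; apply/imsetP/idP => [[x]|eA].
    by rewrite inE => /andP[xA _] ->.
  have /imsetP[x _ ex] := subsetP sA e eA.
  case: (ltngtP (pos x) (pos (m x))) => [opx|clx|/pos_inj e'].
  - by exists x; rewrite // inE -ex eA.
  - by exists (m x); rewrite ?porbit_image // inE porbit_image mK -ex eA.
  - by have := m_neq x; rewrite -e' eqxx.
move=> x y; rewrite !inE => /andP[_ opx] /andP[_ opy] /eqP.
rewrite porbit_involution // => /orP[/eqP //|/eqP e].
by move: opx opy; rewrite e mK; lia.
Qed.

Definition closes := [set x | (porbit m x \in A) && (pos (m x) < pos x)].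

Lemma card_closes : #|closes| = #|A|.
Proof.
rewrite -card_opens -[RHS](card_imset _ (@perm_inj _ m)); apply: eq_card => x.
rewrite inE; apply/andP/imsetP => [[xA clx]|[y]].
  by exists (m x); rewrite ?mK // inE porbit_image xA mK.
by rewrite inE => /andP[yA opy] ->; rewrite porbit_image mK.
Qed.

End Counting.

Lemma card_darts : #|D| = #|porbits m|.*2.
Proof.
rewrite -addnn -{1}card_opens // -card_closes // -cardsT -(cardsID (opens
  (porbits m))).
rewrite setTI; congr (_ + _); apply: eq_card => x;
  rewrite !inE imset_f //= andbT.
by rewrite -leqNgt leq_eqVlt pos_eq (negbTE (m_neq x)).
Qed.

Lemma card_porbits_single : #|porbits s| = 1.
Proof.
rewrite (_ : porbits s = [set porbit s r]) ?cards1 //; apply/setP=> u.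
rewrite inE; apply/imsetP/eqP => [[x _ ->]|->]; last by exists r.
by apply/eqP; rewrite eq_porbit_mem.
Qed.

Lemma noncrossing_set1 x : noncrossing [set porbit m x].
Proof.
move=> y z; rewrite !inE => /eqP<-; rewrite porbit_involution //.
by move=> /orP[]/eqP->; lia.
Qed.

(** The #|A| exchanges turn the more than #|A| cycles of c into a single one,
    so that c after the exchange over A without the chords of x and y has at
    least three cycles. This permutation is also s after the exchange over
    these two chords. The exchange over one of them cuts s into two cycles; if
    the chords cross, the ends of the other one are then in different cycles,
    and its exchange merges them into one. *)
Lemma noncrossing_of_card A (c : {perm D}) : A \subset porbits m ->
  (toggle_perm m A * c)%g = s -> #|A| < #|porbits c| -> noncrossing A.
Proof.
move=> sA Ac ltA x y xA yA lt_xy.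
have [//|nlt] := boolP (_ < _ < _).
have nxy : porbit m x != porbit m y.
  rewrite porbit_involution //; apply/negP=> /orP[]/eqP e.
    by move: lt_xy; rewrite e; lia.
  by move: lt_xy; rewrite e mK; lia.
pose B := A :\ porbit m x :\ porbit m y.
have BA : B \subset A by rewrite !subDset subsetU // orbC subsetUr.
have cB : #|A| = #|B|.+2.
  by rewrite (cardsD1 (porbit m x)) xA (cardsD1 (porbit m y)) !inE yA eq_sym
    nxy.
have := card_porbits_toggle mK c (subset_trans BA sA).
have -> : (toggle_perm m B * c = tperm y (m y) * (tperm x (m x) * s))%g.
  rewrite -Ac !mulgA -!toggle_perm1 //; congr (_ * _)%g.
  apply/permP=> d; rewrite !permM !permE !toggle_symdiff //.
  congr (toggle _ _ _); apply/setP=> f; rewrite !in_symdiff !inE.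
  have [->|_] := eqVneq f (porbit m x); first by rewrite (negbTE nxy) xA.
  by have [->|_] := eqVneq f (porbit m y); rewrite ?yA //; case: (f \in A).
have := porbits_mul_tperm s x (m x); rewrite /= card_porbits_single.
have := porbits_mul_tperm (tperm x (m x) * s)%g y (m y).
rewrite /= (_ : y \notin _) //.
  move: cB ltA; move: #|A| #|B| => a b.
  move: #|porbits c| => k; set t := (tperm x (m x) * s)%g.
  move: #|porbits (tperm y (m y) * t)%g| #|porbits t| => l z.
  case: (x \notin porbit s (m x)); case: (y != m y); case: (x != m x) => /=;
    lia.
rewrite -toggle_perm1 //; apply/negP=> /(porbit_within (@noncrossing_set1 x)
  (set11 _)).
have := nxy; rewrite porbit_involution // eq_sym => /norP[_].
rewrite -[x](mK x) (inj_eq perm_inj) mK.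
have mne : m y != m x by rewrite (inj_eq perm_inj); apply: contraNneq nxy => ->.
rewrite -pos_eq; rewrite -pos_eq in mne; move: nlt lt_xy; rewrite /within; lia.
Qed.

End Chords.

(** * The recursive construction of tilde T *)
Section LastSorted.
Variables (D : eqType) (f : D -> nat).

Lemma last_filter_sorted (P : pred D) (l : seq D) x0 i :
    sorted (fun y z => f y < f z) l -> i \in l -> P i -> injective f ->
    (forall x, x \in l -> P x -> f x <= f i) ->
  last x0 [seq x <- l | P x] = i.
Proof.
move=> sl il Pi injf maxi; set l' := filter P l.
have il' : i \in l' by rewrite mem_filter Pi.
have tr : transitive (fun y z => f y <= f z) by move=> y x z; apply: leq_trans.
have sl' : sorted (fun y z => f y <= f z) l'.
  by apply: sorted_filter => //; apply: sub_sorted sl => x y /ltnW.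
have zl' : last x0 l' \in l' by case: (l') il' => //= a s _; apply: mem_last.
apply/injf/eqP; rewrite eqn_leq; apply/andP; split.
  by move: zl'; rewrite mem_filter => /andP[Pz zl]; apply: maxi.
rewrite -{1}(nth_index x0 il') -nth_last.
have refl : reflexive (fun y z => f y <= f z) by move=> y; apply: leqnn.
have := sorted_leq_nth tr refl x0 sl'; apply; rewrite ?inE ?index_mem //.
  by rewrite prednK //; case: (l') il'.
by rewrite -ltnS prednK ?index_mem //; case: (l') il'.
Qed.

End LastSorted.

Section Map.
Variable M : rooted_map.
Notation D := (dart M).
Notation m := (opp M).
Implicit Types (S T X : {set {set dart M}}) (d x y z i : dart M).

Let mK := @opp_involutive M.
Let m_neq := @opp_neq M.

Definition turn_perm T : {perm D} := (toggle_perm m T * (cw M)^-1)%g.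

Lemma turn_permE T d : turn_perm T d = turn T d.
Proof.
rewrite toggle_permE /toggle /turn fnextE -/(edge_of d); by case: ifP.
Qed.

Definition single T := forall d, d \in porbit (turn_perm T) (root M).

(** The loops of all edge sets come from those of a single one. *)
Lemma turn_perm_symdiff S X :
  turn_perm (symdiff S X) = (toggle_perm m X * turn_perm S)%g.
Proof.
rewrite /turn_perm mulgA; congr (_ * _)%g; apply/permP=> d.
by rewrite permM !permE toggle_symdiff.
Qed.

Lemma toggle_turn_cw T : (toggle_perm m T * turn_perm T)%g = (cw M)^-1%g.
Proof.
rewrite -turn_perm_symdiff; apply/permP=> d; rewrite toggle_permE.
by rewrite /toggle in_symdiff eqxx.
Qed.

Lemma toggle_turn_fnext T :
  (toggle_perm m (dual_edges T) * turn_perm T)%g = fnext M.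
Proof.
rewrite -turn_perm_symdiff; apply/permP=> d; rewrite toggle_permE fnextE.
rewrite /toggle in_symdiff inE imset_f //; by case: (_ \in T).
Qed.

Lemma orbit_turn T d : orbit (turn T) d = orbit (turn_perm T) d.
Proof.
have e x : turn T x = turn_perm T x by rewrite turn_permE.
rewrite /orbit /fingraph.order (eq_card (eq_fconnect e d)).
by move: #|fconnect (turn_perm T) d| => n; elim: n d => //= n IHn d;
  rewrite IHn e.
Qed.

Lemma in_loop T x y : (y \in loop T x) = (y \in porbit (turn_perm T) x).
Proof. by rewrite inE orbit_turn porbit_fconnect fconnect_orbit. Qed.

Lemma mem_edges d : edge_of d \in edges M.
Proof. exact: imset_f. Qed.

Lemma share_edge_sym T : symmetric (share_edge T).
Proof.
by move=> x y; rewrite /share_edge disjoint_sym [edge_of x == _]eq_sym.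
Qed.

Lemma adj_outside_sym T : symmetric (adj_outside T).
Proof. by move=> x y; rewrite /adj_outside share_edge_sym andbCA. Qed.

Lemma share_edge_turn T x : share_edge T x (turn_perm T x).
Proof.
apply/orP; left; rewrite turn_permE -setI_eq0; apply/set0Pn; exists (turn T x).
by rewrite !inE eqxx orbT.
Qed.

(** Two triangles share a side of Q only if they are consecutive in a loop. *)
Lemma share_edgeP T x y : share_edge T x y ->
  y \in porbit (turn_perm T) x \/ y = m x.
Proof.
case/orP; last first.
  rewrite eq_sym /edge_of porbit_involution // => /orP[]/eqP->; last by right.
  by left; rewrite porbit_id.
rewrite -setI_eq0 => /set0Pn[z]; rewrite !inE => /andP[zx zy]; left.
have inz u : (z == u) || (z == turn T u) ->
    porbit (turn_perm T) u = porbit (turn_perm T) z.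
  by case/orP=> /eqP-> //; rewrite -turn_permE porbit_image.
by rewrite -eq_porbit_mem (inz x) // (inz y).
Qed.

(** One step of the construction for the symmetric difference of S and X, where
    S has a single loop and X is fresh. The outermost chords of X are those met
    by the root loop; the components outside this loop are their intervals. *)
Section Flip.
Variables (S X : {set {set dart M}}).
Hypothesis singS : single S.
Hypothesis sX : X \subset edges M.
Local Notation s := (turn_perm S).
Local Notation r := (root M).
Local Notation posS := (pos s r).
Hypothesis frX : fresh m s r X.
Let T := symdiff S X.
Let q := turn_perm T.
Let ncX := fresh_noncrossing mK singS frX.

Let qE : q = (toggle_perm m X * s)%g.
Proof. exact: turn_perm_symdiff. Qed.

Let outer i := [&& i \in porbit q r, edge_of i \in X & posS i < posS (m i)].

Let interval i : {set D} := [set y | within m s r i y].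

Let interval_outside i y : outer i -> y \in interval i -> y \notin porbit q r.
Proof.
case/and3P=> ir iX opi; rewrite inE qE in_root_porbit // => iy.
by rewrite negb_forall; apply/existsP; exists i; rewrite iX iy.
Qed.

Let outer_exists y :
  y \notin porbit q r -> exists2 i, outer i & y \in interval i.
Proof.
rewrite qE => /(outermost mK singS ncX)[i [ir iX iy]]; exists i;
  rewrite ?inE //.
by apply/and3P; rewrite qE; split=> //; move: iy; rewrite /within; lia.
Qed.

(** A chord with an end inside the interval cannot close after it, as X is
    fresh. It cannot come from the interval of an earlier outermost chord
    either, for it would close after that one. *)
Let interval_closed i y z :
  outer i -> y \in interval i -> adj_outside T y z -> z \in interval i.
Proof.
move=> oi yi /and3P[]; rewrite !in_loop -/q => yr zr /share_edgeP[zy|zy].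
  move: zy yi; rewrite -/q qE !inE => zy.
  by rewrite (porbit_within mK singS ncX _ zy) //; case/and3P: oi.
have [e|nmi] := eqVneq y (m i).
  by case/and3P: oi => ir _ _; rewrite zy e mK ir in zr.
have nyi : posS y != posS (m i) by rewrite (pos_eq singS).
have yz : y = m z by rewrite zy mK.
case/and3P: (oi) => ir iX opi; move: yi; rewrite !inE /within => yi.
have zlt : posS z < posS (m i) by rewrite zy; apply: (frX iX); lia.
rewrite (ltnW zlt) andbT ltnNge; apply/negP => le_zi.
have [i' oi'] := outer_exists zr; rewrite inE /within => zi'.
have [e|nmi'] := eqVneq z (m i').
  by case/and3P: oi' => i'r _ _; rewrite yz e mK i'r in yr.
have nzi : posS z != posS (m i') by rewrite (pos_eq singS).
case/and3P: (oi') => i'r i'X opi'.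
have ylt : posS y < posS (m i') by rewrite yz; apply: (frX i'X); lia.
by have := @interval_outside i' i oi'; rewrite inE /within ir; lia.
Qed.

(** Each triangle of the interval other than the last one shares an edge with
    the next one, or with the other triangle of its quadrilateral, which does
    so or comes later. *)
Let interval_connect i y :
  outer i -> y \in interval i -> connect (adj_outside T) y (m i).
Proof.
move=> oi; have [n] := ubnP (posS (m i) - posS y);
  elim: n y => // n IHn y le_n yi.
have nr z : z \in interval i -> z \notin loop T r.
  by rewrite in_loop; apply: interval_outside.
have step z : adj_outside T y z -> z \in interval i -> posS y < posS z ->
    connect (adj_outside T) y (m i).
  move=> yz zi lt_yz; apply: connect_trans (connect1 yz) (IHn _ _ zi).
  by move: zi; rewrite inE /within; lia.
have [->|nmi] := eqVneq y (m i); first exact: connect0.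
have [_ iX opi] := and3P oi.
have lt_y : posS y < posS (m i).
  by move: nmi yi; rewrite -(pos_eq singS) inE /within; lia.
have lt_iy : posS i < posS y by move: yi; rewrite inE => /andP[].
have posy : posS (s y) = (posS y).+1.
  rewrite pos_succ //; case: eqP => // e.
  by have := within_succ m singS i y; rewrite e /within pos_root; lia.
have syi : s y \in interval i by rewrite inE within_succ //; lia.
have [yX|nyX] := boolP (edge_of y \in X); last first.
  apply: (step (s y)) => //; last by rewrite posy.
  rewrite /adj_outside !nr //=.
  rewrite (_ : s y = turn_perm T y) ?share_edge_turn // -/q qE toggle_permE.
  by rewrite /toggle (negbTE nyX).
have myi : m y \in interval i.
  by have := ncX iX yX; rewrite lt_iy lt_y inE /within => /(_ isT); lia.
have ymy : share_edge T y (m y).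
  by apply/orP; right; rewrite /edge_of porbit_image.
have [opy|cly] := ltnP (posS y) (posS (m y)).
  by apply: (step (m y)); rewrite // /adj_outside !nr.
apply: connect_trans (_ : connect _ y (m y)) _.
  by rewrite connect1 // /adj_outside !nr.
apply: connect_trans (_ : connect _ (m y) (s y)) _; last first.
  by apply: IHn => //; rewrite posy; lia.
rewrite connect1 // /adj_outside !nr //=.
rewrite (_ : s y = turn_perm T (m y)) ?share_edge_turn // -/q qE toggle_permE.
by rewrite /toggle porbit_image -/(edge_of y) yX mK.
Qed.

Let component i x : outer i -> x \in interval i ->
  [set y | connect (adj_outside T) x y] = interval i.
Proof.
move=> oi xi; apply/setP=> y; rewrite [LHS]inE;
  apply/idP/idP => [/connectP[l]|yi].
  elim: l x xi => [|z l IHl] x xi /= => [_ -> //|/andP[xz pl]].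
  by apply: IHl pl; apply: interval_closed xz.
apply: connect_trans (interval_connect oi xi) _.
by rewrite (sym_connect_sym (@adj_outside_sym T)) interval_connect.
Qed.

(** A dart outside the interval whose edge ends strictly inside comes before i,
    since X is fresh; and the root loop runs through its darts in increasing
    order. *)
Let last_contact_interval i : outer i -> last_contact T (interval i) = i.
Proof.
move=> oi; have [ir iX opi] := and3P oi.
rewrite /last_contact orbit_turn; apply: (@last_filter_sorted _ posS).
- by rewrite -/q qE; apply: sorted_orbit.
- by rewrite -fconnect_orbit -porbit_fconnect.
- apply/existsP; exists (m i); rewrite inE /within opi leqnn.
  by apply/orP; right; rewrite /edge_of porbit_image.
- exact: pos_inj.
move=> x; rewrite -fconnect_orbit -porbit_fconnect -/q => xr.
case/existsP=> y /andP[yi /share_edgeP[xy|xy]].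
  have := interval_outside oi yi; rewrite -eq_porbit_mem.
  by move: xy xr; rewrite -!eq_porbit_mem => /eqP-> ->.
have [->//|nxi] := eqVneq x i.
have xni : x \notin interval i by apply: contraL xr; apply: interval_outside.
have yx : x = m y by rewrite xy mK.
have nyi : posS y != posS (m i).
  by rewrite (pos_eq singS); apply: contraNneq nxi => e; rewrite yx e mK.
have xlt : posS x < posS (m i).
  rewrite yx; apply: (frX iX); move: yi; rewrite inE /within; lia.
by move: xni; rewrite inE /within; lia.
Qed.

(** The set X' is X without its outermost chords, of which there is at least
    one as soon as X is not empty. *)
Lemma flip_step_fresh :
  exists X', [/\ X' \subset X, flip_step T = symdiff S X'
               & X != set0 -> #|X'| < #|X| ].
Proof.
pose X0 := [set edge_of i | i in outer].
have eX0 : [set edge_of (last_contact T C) | C in outer_comps T] = X0.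
  apply/setP=> e; apply/imsetP/imsetP => [[_ /imsetP[x xr ->] ->]|[i oi ->]].
    rewrite inE in_loop in xr; have [i oi xi] := outer_exists xr.
    by exists i; rewrite // (component oi xi) last_contact_interval.
  have mi : m i \in interval i.
    by have [_ _ opi] := and3P oi; rewrite inE /within opi leqnn.
  exists (interval i); last by rewrite last_contact_interval.
  apply/imsetP; exists (m i); last by rewrite (component oi).
  by rewrite inE in_loop (interval_outside oi).
have sX0 : X0 \subset X by apply/subsetP=> _ /imsetP[i /and3P[_ iX _] ->].
exists (X :\: X0); split; first exact: subsetDl.
  rewrite /flip_step eX0 -/(symdiff T X0); apply/setP=> e; rewrite !in_symdiff.
  rewrite inE; have := subsetP sX0 e.
  by case: (e \in X0) => [->|_]; case: (e \in X); case: (e \in S).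
case/set0Pn=> e eX; have /imsetP[x _ ex] := subsetP sX e eX.
wlog opx : x ex / posS x < posS (m x).
  move=> H; case: (ltngtP (posS x) (posS (m x))) => [|clx|/(pos_inj singS) e'].
  - exact: H.
  - by apply: (H (m x)); rewrite ?porbit_image ?mK.
  - by have := m_neq x; rewrite -e' eqxx.
have xX : porbit m x \in X by rewrite -ex.
have := close_notin_root_porbit mK singS ncX xX opx.
rewrite -qE => /outer_exists[i oi _].
rewrite -(cardsID X0 X) (setIidPr sX0) -[X in X < _]add0n ltn_add2r.
by apply/card_gt0P; exists (edge_of i); apply/imsetP; exists i.
Qed.

End Flip.

(** Each step removes the outermost chords of the symmetric difference of S and
    T, until none is left. *)
Lemma tilde_unique S T : T \subset edges M -> S \subset edges M -> single S ->
  fresh m (turn_perm S) (root M) (symdiff S T) -> tilde T = S.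
Proof.
move=> sT sS singS frX.
have sX : symdiff S T \subset edges M.
  apply/subsetP=> e; rewrite in_symdiff.
  case: (boolP (e \in S)) => [/(subsetP sS) //|_].
  by case: (boolP (e \in T)) => [/(subsetP sT)|].
have le_D : #|symdiff S T| <= #|D|.
  exact: leq_trans (subset_leq_card sX) (leq_imset_card _ _).
suff iterS n X : X \subset edges M -> fresh m (turn_perm S) (root M) X ->
    #|X| <= n -> iter n (@flip_step M) (symdiff S X) = S.
  by have := iterS #|D| _ sX frX le_D; rewrite symdiffK.
elim: n X {sX frX le_D} => [|n IHn] X sX frX le_Xn.
  move: le_Xn; rewrite leqn0 cards_eq0 => /eqP->; apply/setP=> e.
  by rewrite in_symdiff inE eqbF_neg negbK.
have [X' [sX' e ltX]] := flip_step_fresh singS sX frX.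
rewrite iterSr e; apply: IHn.
- exact: subset_trans sX' sX.
- by move=> x y xX'; apply: frX; apply: (subsetP sX').
have [X0|/ltX lt] := eqVneq X set0; last by rewrite -ltnS (leq_trans lt).
by move: (subset_leq_card sX'); rewrite X0 cards0 => h; apply: leq_trans h _.
Qed.

(** A loop that is closed under m is closed under cw, hence is everything as
    the map is connected. *)
Lemma root_loop_exit T d : d \notin porbit (turn_perm T) (root M) ->
  exists2 x, x \in porbit (turn_perm T) (root M)
           & m x \notin porbit (turn_perm T) (root M).
Proof.
set P := porbit _ _ => dP.
have [/existsP[x /andP[xP mxP]]|/existsPn no] :=
    boolP [exists x, (x \in P) && (m x \notin P)]; first by exists x.
have mP x : x \in P -> m x \in P.
  by move=> xP; have := no x; rewrite xP negbK.
have turnP x : (turn_perm T x \in P) = (x \in P).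
  by rewrite /P -!eq_porbit_mem porbit_image.
have toggleP x : x \in P -> toggle m T x \in P.
  by rewrite /toggle; case: ifP => // _; apply: mP.
suff: d \in P by rewrite (negbTE dP).
have /connectP[l pl ->] := map_connected (root M) d.
have: root M \in P by apply: porbit_id.
elim: l (root M) pl => [//|y l IHl] x /= /andP[xy pl] xP; apply: IHl pl _.
case/orP: xy => /eqP->; last exact: mP.
have e : turn_perm T (toggle m T (cw M x)) = x.
  have := toggle_turn_cw T => /permP/(_ (cw M x)).
  by rewrite toggle_permE permK.
have := toggleP (toggle m T (cw M x)); rewrite -turnP e => /(_ xP).
by rewrite toggle_symdiff // /toggle in_symdiff eqxx.
Qed.

Lemma path_redirect (f f1 : D -> D) x x' z (l : seq D) :
    f1 x' = f x -> {in l, f1 =1 f} ->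
  fpath f x (rcons l z) -> fpath f1 x' (rcons l z).
Proof.
move=> e1; case: l => [|y l] /= e; first by rewrite e1.
case/andP=> xy pl; rewrite e1 xy /=.
elim: l y e {xy} pl => [|w l IHl] y e /=.
  by rewrite e ?mem_head.
case/andP=> yw pl; rewrite e ?mem_head // yw IHl //.
by move=> u ul; rewrite e // in_cons ul orbT.
Qed.

(** Flipping the edge of x makes the root loop go, after x, around the loop of
    m x, starting behind m x and ending with m x, and then continue as
    before. *)
Lemma merge_loops T x l1 l2 : orbit (turn_perm T) (root M) = l1 ++ x :: l2 ->
    m x \notin porbit (turn_perm T) (root M) ->
  let T1 := symdiff T [set edge_of x] in
  exists l, orbit (turn_perm T1) (root M) = l1 ++ x :: l ++ m x :: l2.
Proof.
set f := turn_perm T; rewrite porbit_fconnect fconnect_orbit => el;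
  rewrite el => mxl T1.
have uniq_l : uniq (l1 ++ x :: l2) by rewrite -el orbit_uniq.
have f1E d : turn_perm T1 d = f (if (d == x) || (d == m x) then m d else d).
  by rewrite turn_perm_symdiff toggle_permE toggle_set1.
have [c ec] : exists c, orbit f (m x) = m x :: c.
  by rewrite /orbit -orderSpred; eexists.
have uniq_c : uniq (m x :: c) by rewrite -ec orbit_uniq.
have cyc_c : fpath f (m x) (rcons c (m x)).
  by have := cycle_orbit (@perm_inj _ f) (m x); rewrite ec.
have disj : [disjoint m x :: c & l1 ++ x :: l2].
  rewrite disjoint_has; apply/hasPn => y; rewrite -ec -el -!fconnect_orbit.
  rewrite -!porbit_fconnect => ymx; apply: contra mxl => yr.
  rewrite -el -fconnect_orbit -porbit_fconnect -eq_porbit_mem.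
  by move: ymx yr; rewrite -!eq_porbit_mem => /eqP-> .
have [nc nl] : {in c, forall y, y != x /\ y != m x}
               /\ {in l2 ++ l1, forall y, y != x /\ y != m x}.
  have xl : x \in l1 ++ x :: l2 by rewrite mem_cat mem_head orbT.
  split=> y yl; split; apply: contraTneq yl => ->.
  - move: disj; rewrite disjoint_sym => /disjointFr/(_ xl).
    by rewrite in_cons => /norP[].
  - by case/andP: uniq_c.
  - by move: uniq_l; rewrite -(rot_uniq (size l1)) rot_size_cat /= => /andP[].
  - by move: mxl; rewrite !mem_cat in_cons =>
      /norP[/negbTE-> /norP[_ /negbTE->]].
have cyc_l : fpath f x (rcons (l2 ++ l1) x).
  have := cycle_orbit (@perm_inj _ f) (root M).
  by rewrite el -(rot_cycle (size l1)) rot_size_cat.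
exists c.
have cyc : fcycle (turn_perm T1) (l1 ++ x :: c ++ m x :: l2).
  rewrite -(rot_cycle (size l1)) rot_size_cat /= -catA -cat_rcons rcons_cat.
  rewrite cat_path last_rcons (@path_redirect f _ (m x)) //=; first last.
  - by move=> y yc; have [nyx nymx] := nc y yc;
      rewrite f1E (negbTE nyx) (negbTE nymx).
  - by rewrite f1E eqxx.
  apply: (@path_redirect f _ x) => //; first by rewrite f1E eqxx orbT mK.
  by move=> y yl; have [nyx nymx] := nl y yl;
    rewrite f1E (negbTE nyx) (negbTE nymx).
have u : uniq (l1 ++ x :: c ++ m x :: l2).
  rewrite (perm_uniq (_ : perm_eq _ ((m x :: c) ++ (l1 ++ x :: l2)))).
    by rewrite cat_uniq uniq_c uniq_l andbT /= -disjoint_has disjoint_sym.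
  by apply/seq.permP=> p; rewrite !count_cat /= !count_cat /=; lia.
have [t et] : exists t, l1 ++ x :: c ++ m x :: l2 = root M :: t.
  move: el; rewrite /orbit -orderSpred /=.
  by case: (l1) => [[-> _]|y l [-> _]]; eexists.
by rewrite et in cyc u *; apply: orbit_of_fcycle.
Qed.

(** Flip the edge of the last dart x of the root loop whose opposite dart is
    not on this loop, and apply the induction hypothesis, which gives S. In the
    order of S, only the end of the old root loop comes after m x: every edge
    of that part stays on the old root loop, so that no detour to another loop
    starts there. For the same reason a chord that ends there has both ends on
    the old root loop, hence does not start between x and m x, and the
    difference remains fresh when the chord of x is added to it. *)
Lemma fresh_tree_exists T : T \subset edges M ->
  exists S, [/\ S \subset edges M, single S
             & fresh m (turn_perm S) (root M) (symdiff S T)].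
Proof.
have [n] := ubnP #|[set d | d \notin porbit (turn_perm T) (root M)]|.
elim: n T => // n IHn T le_n sT; set P := porbit (turn_perm T) (root M) in le_n.
have [/existsP[d dP]|/existsPn all] := boolP [exists d, d \notin P]; last first.
  exists T; split=> // [d|x y]; first by have := all d; rewrite negbK.
  by rewrite in_symdiff eqxx.
have [x0 x0P mx0P] := root_loop_exit dP.
have PE y : (y \in P) = (y \in orbit (turn_perm T) (root M)).
  by rewrite /P porbit_fconnect fconnect_orbit.
have /split_last[l1 [x [l2 [el]]]] :
    has (fun x => m x \notin P) (orbit (turn_perm T) (root M)).
  by apply/hasP; exists x0; rewrite -?PE.
move=> mxP /hasPn l2P; have [c el'] := merge_loops el mxP.
set T1 := symdiff _ _ in el'.
have sT1 : T1 \subset edges M.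
  apply/subsetP=> e; rewrite in_symdiff inE;
    have [->|_] := eqVneq e (edge_of x).
    by rewrite mem_edges.
  by rewrite eqbF_neg negbK => /(subsetP sT).
have P1E y : (y \in porbit (turn_perm T1) (root M)) =
  (y \in P) || (y \in m x :: c).
  rewrite PE porbit_fconnect fconnect_orbit el' el !(mem_cat, in_cons).
  by case: (y \in l1); case: (y == x); case: (y \in c); case: (y == m x);
    case: (y \in l2).
have [|S [sS singS frS]] := IHn T1 _ sT1.
  rewrite -ltnS (leq_trans _ le_n) // ltnS; apply: proper_card; apply/properP.
  split; first by apply/subsetP=> y; rewrite !inE P1E => /norP[].
  by exists (m x); rewrite inE // P1E mem_head orbT.
exists S; split=> //.
have ncX := fresh_noncrossing mK singS frS.
have eT1 : turn_perm T1 = (toggle_perm m (symdiff S T1) * turn_perm S)%g.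
  by rewrite -turn_perm_symdiff symdiffK.
have := sorted_orbit mK singS ncX; rewrite -eT1 el'.
set posS := pos _ _.
have tr : transitive (fun y z => posS y < posS z) by move=> y x' z;
  apply: ltn_trans.
rewrite (sorted_pairwise tr) pairwise_cat pairwise_cons pairwise_cat
  pairwise_cons.
rewrite all_cat /= => /and4P[/allrelP l1x _ /and3P[/allP cx xmx _] /and4P[cmx _
  /allP l2x _]].
have {}l1x y : y \in l1 -> posS y < posS x.
  by move=> yl1; apply: l1x => //; rewrite mem_head.
have {}cmx y : y \in c -> posS y < posS (m x).
  by move=> yc; have /allrelP := cmx; apply=> //; rewrite mem_head.
have P1P y : y \in porbit (turn_perm T1) (root M) ->
    y \in l2 \/ posS y <= posS (m x).
  rewrite porbit_fconnect fconnect_orbit el' mem_cat !inE mem_cat inE.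
  case/or4P=> [/l1x|/eqP->|/cmx|/orP[/eqP->|]]; by [left|right; lia].
(* darts after m x have their edge on the old root loop *)
have late z : posS (m x) < posS z -> m z \in P.
  move=> lt_z; have [z1|] := boolP (z \in porbit (turn_perm T1) (root M)).
    by case: (P1P z z1) => [/l2P|]; [rewrite negbK|lia].
  rewrite {1}eT1 => /(outermost mK singS ncX)[i [i1 iX iz]].
  have opi : posS i < posS (m i) by move: iz; rewrite /within -/posS; lia.
  have := close_notin_root_porbit mK singS ncX iX opi;
    rewrite -eT1 P1E => /norP[miP _].
  rewrite -eT1 in i1; case: (P1P i i1) => [/l2P|]; first by rewrite miP.
  rewrite leq_eqVlt (pos_eq singS) => /orP[/eqP e|lt_i].
    by move: miP; rewrite e mK PE el mem_cat mem_head orbT.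
  have : m x \in porbit (turn_perm T1) (root M) by rewrite P1E mem_head orbT.
  rewrite eT1 in_root_porbit // => /forallP/(_ i); rewrite iX /=.
  by move: iz; rewrite /within -/posS; lia.
(* between x and m x there is no dart of the old root loop *)
have early z : z \in P -> posS x < posS z -> posS (m x) < posS z.
  rewrite PE el mem_cat in_cons => /or3P[/l1x|/eqP->|/l2x]; lia.
move=> u y uX lt_y; have [e|ne] := eqVneq (edge_of u) (edge_of x); last first.
  apply: frS lt_y; move: uX; rewrite !in_symdiff inE -/(edge_of u) (negbTE ne).
  by case: (edge_of u \in T); case: (edge_of u \in S).
move: lt_y => /=; rewrite -/posS.
have /orP[/eqP->|/eqP->] : (u == x) || (u == m x).
- by rewrite -porbit_involution //; apply/eqP.
- move=> lt_y; rewrite ltn_neqAle (pos_eq singS) (inj_eq perm_inj) andbC.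
  rewrite leqNgt; apply/andP; split.
    apply/negP=> /late; rewrite mK => /early; lia.
  by apply: contraTneq lt_y => ->; rewrite ltnn.
- by rewrite mK; lia.
Qed.

End Map.

(** * Planarity and the letters of the word *)
Section Planarity.
Variable M : rooted_map.
Notation D := (dart M).
Notation m := (opp M).
Implicit Types (S T X : {set {set dart M}}) (d x y z i : dart M).

Let mK := @opp_involutive M.
Let m_neq := @opp_neq M.

(** The vertex bound V <= |S| + 1 and its dual F <= |E - S| + 1 are equalities
    by the Euler relation, and then each set of chords is as efficient as
    possible in merging cycles. *)
Lemma single_noncrossing S : S \subset edges M -> single S ->
  noncrossing m (turn_perm S) (root M) S
  /\ noncrossing m (turn_perm S) (root M) (dual_edges S).
Proof.
move=> sS singS.
have sS' : dual_edges S \subset edges M by apply: subsetDl.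
have eS : (toggle_perm m S * (cw M)^-1)%g = turn_perm S by [].
have eS' : (toggle_perm m (dual_edges S) * fnext M)%g = turn_perm S.
  rewrite -(toggle_turn_fnext S) mulgA -[RHS]mul1g; congr (_ * _)%g.
  apply/permP=> d; rewrite permM !permE toggle_symdiff //.
  by rewrite /toggle in_symdiff eqxx.
have := card_porbits_toggle mK (fnext M) sS'.
have := card_porbits_toggle mK (cw M)^-1%g sS.
rewrite eS eS' (card_porbits_single singS) porbitsV => leV leF.
have := map_euler M; rewrite -/(edges M) -/(fnext M) -(cardsID S (edges M)).
rewrite (setIidPr sS) -/(dual_edges S) => euler.
split.
  apply: (noncrossing_of_card mK singS sS eS).
  by rewrite porbitsV; move: euler leF; lia.
apply: (noncrossing_of_card mK singS sS' eS').
by move: euler leV; lia.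
Qed.

Section Tilde.
Variable T : {set {set dart M}}.
Hypothesis sT : T \subset edges M.
Notation S := (tilde T).
Notation X := (symdiff (tilde T) T).
Notation s := (turn_perm (tilde T)).
Notation r := (root M).

Lemma tilde_spec : [/\ S \subset edges M, single S & fresh m s r X].
Proof.
have [S0 [sS0 singS0 frS0]] := fresh_tree_exists sT.
by rewrite (tilde_unique sT sS0 singS0 frS0).
Qed.

Let sS : S \subset edges M. Proof. by have [] := tilde_spec. Qed.

Lemma tilde_single : single S. Proof. by have [] := tilde_spec. Qed.
Let singS := tilde_single.

Lemma tilde_fresh : fresh m s r X. Proof. by have [] := tilde_spec. Qed.

Lemma tilde_noncrossing : noncrossing m s r S.
Proof. by have [] := single_noncrossing sS singS. Qed.

Lemma tilde_dual_noncrossing : noncrossing m s r (dual_edges S).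
Proof. by have [] := single_noncrossing sS singS. Qed.

Lemma porbit_cw y : porbit (cw M) y = porbit (toggle_perm m S * s)%g y.
Proof. by rewrite toggle_turn_cw porbitV. Qed.

Lemma porbit_fnext y :
  porbit (fnext M) y = porbit (toggle_perm m (dual_edges S) * s)%g y.
Proof. by rewrite toggle_turn_fnext. Qed.

Lemma vdistE d : vdist T d = depth m s r S d.
Proof. exact: (dist_depth mK m_neq singS tilde_noncrossing porbit_cw). Qed.

Lemma fdistE d : fdist T d = depth m s r (dual_edges S) d.
Proof. exact: (dist_depth mK m_neq singS tilde_dual_noncrossing porbit_fnext).
  Qed.

(** What the letter of d must be according to the chord diagram of tilde T. *)
Definition chord_letter d : symbol :=
  if pos s r d < pos s r (m d) then if edge_of d \in S then bH else bC
  else if edge_of d \in X then oF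
  else if edge_of d \in S then oh else oc.

(** The triangle of an edge of tilde T leads to the vertex at the other end of
    this edge, one level deeper exactly if the chord opens, and keeps the face;
    the triangle of another edge keeps the vertex and changes the face
    likewise. *)
Lemma letterE d : letter T d = chord_letter d.
Proof.
have fictE : fictional T d = (edge_of d \in X).
  by rewrite /fictional in_symdiff eq_sym.
rewrite /letter fictE /chord_letter /tilde_letter -turn_permE !vdistE !fdistE.
have dturn (A : {set {set D}}) : noncrossing m s r A -> edge_of d \in A ->
    depth m s r A (s d) = depth m s r A (m d).
  move=> ncA dA; rewrite -(depth_turn mK singS ncA (m d)).
  by rewrite /toggle porbit_image -/(edge_of d) dA mK.
have dstay (A : {set {set D}}) : noncrossing m s r A -> edge_of d \notin A ->
    depth m s r A (s d) = depth m s r A d.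
  move=> ncA dA; rewrite -(depth_turn mK singS ncA d).
  by rewrite /toggle -/(edge_of d) (negbTE dA).
have dV : (edge_of d \in dual_edges S) = (edge_of d \notin S).
  by rewrite inE mem_edges andbT.
have dD (A : {set {set D}}) : noncrossing m s r A -> edge_of d \in A ->
    if pos s r d < pos s r (m d) then depth m s r A (s d) = (depth m s r A d).+1
    else depth m s r A d = (depth m s r A (s d)).+1.
  move=> ncA dA; rewrite dturn //; case: ltngtP => [opd|cld|/(pos_inj singS) e].
  - exact: (depth_edge mK singS).
  - have := @depth_edge _ _ _ r mK singS A ncA (m d).
    by rewrite mK porbit_image => /(_ dA cld).
  - by have := m_neq d; rewrite -e eqxx.
have [dS|nS] := boolP (edge_of d \in S).
  have := dD _ tilde_noncrossing dS; case: ifP => _ ->; first by rewrite ltnSn.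
  by rewrite ltnNge leqnSn ltnSn /=; case: (_ \in X).
rewrite (dstay _ tilde_noncrossing nS) ltnn.
have := dD _ tilde_dual_noncrossing; rewrite dV => /(_ nS).
case: ifP => _ ->; first by rewrite ltnSn.
by rewrite ltnNge leqnSn /=; case: (_ \in X).
Qed.

Lemma card_dart : #|D| = (num_edges M).*2.
Proof.
exact: (card_darts mK m_neq singS).
Qed.

End Tilde.
End Planarity.

(** * Reduction of words *)
Section Words.
Implicit Types (W R : seq symbol) (b o x : symbol) (mu : nat -> nat).

Lemma consumes_burger o b : consumes o b -> is_burger b.
Proof. by case: o; case: b. Qed.

Lemma consumes_order o b : consumes o b -> ~~ is_burger o.
Proof. by case: o; case: b. Qed.

Lemma del_last_split (p : pred symbol) R1 b R2 :
  p b -> ~~ has p R2 -> del_last p (R1 ++ b :: R2) = R1 ++ R2.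
Proof.
move=> pb npR2; rewrite /del_last.
have -> : rev (R1 ++ b :: R2) = rev R2 ++ b :: rev R1.
  by rewrite rev_cat rev_cons cat_rcons.
rewrite find_cat has_rev (negbTE npR2) /= pb addn0 take_size_cat //.
by rewrite -cat_rcons drop_size_cat ?size_rcons // rev_cat !revK.
Qed.

Lemma deleted_split o R1 b R2 : consumes o b -> ~~ has (consumes o) R2 ->
  deleted (R1 ++ b :: R2) o = Some b.
Proof.
move=> ob npR2; rewrite /deleted rev_cat rev_cons cat_rcons filter_cat.
rewrite (_ : [seq _ <- rev R2 | _] = [::]) /= ?ob //.
by apply/eqP; rewrite -[_ == _]negbK -has_filter has_rev.
Qed.

Lemma reduce_rcons W x : reduce (rcons W x) = reduce_step (reduce W) x.
Proof. by rewrite /reduce foldl_rcons. Qed.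

(** The position mu i is matched to i. A burger at i that is still there at the
    end of W has for mu i an arbitrary value that is at least size W, which
    makes the restriction to a prefix a matching without changing mu. The last
    condition is that an order takes the last burger available to it. *)
Definition stack_matching W mu : Prop :=
  [/\ forall i, i < size W -> mu i != i,
      forall i, i < size W -> mu i < size W -> mu (mu i) = i,
      forall i, i < size W -> i < mu i -> is_burger (nth oF W i),
      forall j, j < size W -> mu j < j ->
        consumes (nth oF W j) (nth oF W (mu j))
    & forall j a, j < size W -> mu j < a < j ->
        consumes (nth oF W j) (nth oF W a) -> mu a < j].

Definition open_burgers W mu := [seq i <- iota 0 (size W) | size W <= mu i].

Lemma stack_matching_rcons W x mu :
  stack_matching (rcons W x) mu -> stack_matching W mu.
Proof.
case; rewrite size_rcons => h1 h2 h3 h4 h5.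
have nthW i : i < size W -> nth oF (rcons W x) i = nth oF W i.
  by rewrite nth_rcons => ->.
split=> [i lt_i|i lt_i lt_mi|i lt_i op_i|j lt_j cl_j|j a lt_j lt_a].
- by apply: h1; rewrite leqW.
- by apply: h2; rewrite leqW.
- by rewrite -nthW //; apply: h3; rewrite // leqW.
- by have := h4 j; rewrite !nthW //; [apply=> //; rewrite leqW|lia].
- by have := h5 j a; rewrite !nthW //; [apply=> //; rewrite leqW|lia].
Qed.

Lemma open_burgers_rcons_burger W x mu :
    stack_matching (rcons W x) mu -> is_burger x ->
  open_burgers (rcons W x) mu = rcons (open_burgers W mu) (size W).
Proof.
case; rewrite size_rcons => h1 h2 h3 h4 h5 bx.
have nx : nth oF (rcons W x) (size W) = x by rewrite nth_rcons ltnn eqxx.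
rewrite /open_burgers size_rcons -addn1 iotaD filter_cat /= add0n.
have lt_W := ltnSn (size W).
have op : (size W).+1 <= mu (size W).
  rewrite ltnNge leq_eqVlt negb_or h1 // -leqNgt leqNgt; apply/negP=> cl.
  by have := consumes_order (h4 _ lt_W cl); rewrite nx bx.
rewrite addn1 op cats1; congr rcons; apply: eq_in_filter => i.
rewrite mem_iota add0n => lt_i; apply/idP/idP => [/ltnW //|].
rewrite leq_eqVlt => /orP[/eqP e|//].
by have := h2 i; rewrite -e; lia.
Qed.

Lemma open_burgers_rcons_order W x mu :
    stack_matching (rcons W x) mu -> mu (size W) < size W ->
  exists l1 l2, [/\ open_burgers W mu = l1 ++ mu (size W) :: l2,
    open_burgers (rcons W x) mu = l1 ++ l2
    & forall a, a \in l2 -> ~~ consumes x (nth oF W a)].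
Proof.
case; rewrite size_rcons => h1 h2 h3 h4 h5 cl.
have lt_W := ltnSn (size W); set k := mu (size W) in cl *.
have mk : mu k = size W by apply: h2 => //; apply: leqW.
have nx : nth oF (rcons W x) (size W) = x by rewrite nth_rcons ltnn eqxx.
have split_iota : iota 0 (size W) = iota 0 k ++ k :: iota k.+1 (size W - k.+1).
  by rewrite -{1}(subnKC cl) addSnnS iotaD /= add0n.
have filt l : {in l, forall i, i < size W /\ i != k} ->
    [seq i <- l | size W <= mu i] = [seq i <- l | (size W).+1 <= mu i].
  move=> sl; apply: eq_in_filter => i /sl[lt_i ni].
  apply/idP/idP => [|/ltnW //]; rewrite leq_eqVlt => /orP[/eqP e|//].
  have := h2 (size W) lt_W; rewrite -/k => _.
  have := h2 i; rewrite -e -/k => /(_ (leqW lt_i) lt_W) ki.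
  by rewrite ki eqxx in ni.
exists [seq i <- iota 0 k | size W <= mu i].
exists [seq i <- iota k.+1 (size W - k.+1) | size W <= mu i]; split.
- by rewrite /open_burgers split_iota filter_cat /= mk leqnn.
- rewrite /open_burgers size_rcons -addn1 iotaD filter_cat /= add0n -/k addn1.
  rewrite ltnNge ltnW //= cats0 split_iota filter_cat /= mk ltnn.
  by rewrite !filt // => i; rewrite mem_iota => lt_i; split; lia.
move=> a; rewrite mem_filter mem_iota => /andP[opa lt_a]; apply/negP=> xa.
have := h5 (size W) a lt_W; rewrite -/k nx nth_rcons.
have -> : a < size W by lia.
by move=> /(_ _ xa); lia.
Qed.

Lemma stack_matching_order W x mu : stack_matching (rcons W x) mu ->
  mu (size W) < size W -> consumes x (nth oF W (mu (size W))).
Proof.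
case; rewrite size_rcons => h1 h2 h3 h4 h5 cl.
by have := h4 _ (ltnSn (size W)) cl; rewrite !nth_rcons ltnn eqxx cl.
Qed.

(** Every order finds its burger, hence the reduced word has no orders. *)
Lemma reduce_stack_matching W mu : stack_matching W mu ->
  reduce W = [seq nth oF W i | i <- open_burgers W mu].
Proof.
elim/last_ind: W => [//|W x IHW] mW; have mW' := stack_matching_rcons mW.
have nthW l : {subset l <= open_burgers W mu} ->
    [seq nth oF (rcons W x) i | i <- l] = [seq nth oF W i | i <- l].
  move=> sl; apply/eq_in_map => i /sl; rewrite mem_filter mem_iota nth_rcons.
  by case/and3P=> _ _ ->.
rewrite reduce_rcons (IHW mW') /reduce_step.
have [cl|op] := ltnP (mu (size W)) (size W).
  have xk := stack_matching_order mW cl.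
  have [l1 [l2 [e -> nl2]]] := open_burgers_rcons_order mW cl.
  rewrite (negbTE (consumes_order xk)) e !map_cat /= has_cat /= xk orbT.
  rewrite del_last_split //; last by rewrite has_map -all_predC; apply/allP.
  by rewrite !nthW // => i il; rewrite e mem_cat ?in_cons il ?orbT.
have bx : is_burger x.
  have [h1 _ h3 _ _] := mW; have := h3 (size W); have := h1 (size W).
  rewrite size_rcons nth_rcons ltnn eqxx => /(_ (ltnSn _)) ne; apply=> //.
  by rewrite ltn_neqAle eq_sym ne.
rewrite bx (open_burgers_rcons_burger mW bx) map_rcons nthW //.
by rewrite nth_rcons ltnn eqxx.
Qed.

Lemma stack_matching_take W mu k :
  stack_matching W mu -> stack_matching (take k W) mu.
Proof.
elim/last_ind: W => [//|W x IHW] mW; have mW' := stack_matching_rcons mW.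
rewrite -cats1 take_cat; case: ltnP => [_|le_k]; first exact: IHW.
case: (k - _) => [|n] /=; first by rewrite cats0.
by rewrite cats1.
Qed.

Lemma deleted_stack_matching W mu j :
    stack_matching W mu -> j < size W -> mu j < j ->
  deleted (reduce (take j W)) (nth oF W j) = Some (nth oF W (mu j)).
Proof.
move=> mW lt_j cl; have := stack_matching_take j.+1 mW.
rewrite (take_nth oF lt_j); set x := nth _ _ j => mWx.
have sz : size (take j W) = j by rewrite size_takel // ltnW.
rewrite (reduce_stack_matching (stack_matching_rcons mWx)).
have clx : mu (size (take j W)) < size (take j W) by rewrite sz.
have [l1 [l2 [-> _ nl2]]] := open_burgers_rcons_order mWx clx.
have xk := stack_matching_order mWx clx.
rewrite map_cat /= deleted_split //; last by rewrite has_map -all_predC;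
  apply/allP.
by rewrite sz nth_take.
Qed.

(** Consider the first order on whose partners mu and nu disagree, and say that
    the burger chosen by nu is the later one. As mu did not choose it, an
    earlier order is matched to it by mu, hence also by nu, which matches it
    only once. *)
Lemma stack_matching_unique W mu nu :
    stack_matching W mu -> stack_matching W nu ->
    (forall i, i < size W -> mu i < size W) ->
    (forall i, i < size W -> nu i < size W) ->
  forall i, i < size W -> mu i = nu i.
Proof.
move=> mW nW cmu cnu.
have orders m1 m2 : stack_matching W m1 -> stack_matching W m2 ->
    forall j, j < size W -> m1 j < j -> m2 j < j.
  move=> [_ _ _ h4 _] [h1' _ h3' _ _] j lt_j cl.
  rewrite ltnNge leq_eqVlt eq_sym (negbTE (h1' _ lt_j)) /=; apply/negP => op.
  by have := consumes_order (h4 _ lt_j cl); rewrite h3'.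
have le m1 m2 j : stack_matching W m1 -> stack_matching W m2 ->
    (forall i, i < size W -> m1 i < size W) ->
    (forall i, i < size W -> m2 i < size W) ->
    (forall i, i < j -> m1 i < i -> m2 i = m1 i) ->
    j < size W -> m1 j < j -> m2 j <= m1 j.
  move=> M1 M2 c1 c2 IHj lt_j cl1; have cl2 := orders _ _ M1 M2 j lt_j cl1.
  rewrite leqNgt; apply/negP=> lt.
  have [h1 h2 h3 h4 h5] := M1; have [h1' h2' h3' h4' h5'] := M2.
  have lt_a : m1 (m2 j) < j.
    by apply: h5; rewrite ?lt ?cl2 //; apply: h4'.
  have lt_aW : m2 j < size W by apply: c2.
  have op_a : m2 j < m1 (m2 j).
    rewrite ltn_neqAle eq_sym h1 //= leqNgt; apply/negP=> cla.
    have := consumes_order (h4 _ lt_aW cla).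
    by rewrite (consumes_burger (h4' _ lt_j cl2)).
  have := IHj _ lt_a; rewrite h2 ?(c1 _ lt_aW) // => /(_ op_a) e.
  have := h2' (m1 (m2 j)) (c1 _ lt_aW); rewrite e => /(_ lt_aW).
  by rewrite h2' ?c2 // => ej; rewrite -ej ltnn in lt_a.
have agree j : j < size W -> mu j < j -> nu j = mu j.
  elim/ltn_ind: j => j IHj lt_j cl.
  have clnu := orders _ _ mW nW j lt_j cl.
  have IHi i : i < j -> mu i < i -> nu i = mu i.
    by move=> lt_i; apply: IHj => //; apply: ltn_trans lt_j.
  apply/eqP; rewrite eqn_leq (le mu nu) // (le nu mu) // => i lt_i cli.
  have lt_iW := ltn_trans lt_i lt_j.
  by apply/esym/IHi => //; apply: (orders nu mu).
move=> i lt_i; have [h1 h2 _ _ _] := mW; have [h1' h2' _ _ _] := nW.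
case: (ltngtP (mu i) i) => [cl|op|e]; first by rewrite agree.
  have := agree (mu i) (cmu _ lt_i); rewrite h2 ?cmu // => /(_ op) e.
  by rewrite -[in RHS]e h2' ?cmu // e.
by have := h1 _ lt_i; rewrite e eqxx.
Qed.

(** An order that is once in a reduced word stays there. *)
Lemma reduce_burgers_rcons W x : all is_burger (reduce (rcons W x)) ->
  all is_burger (reduce W) /\ (~~ is_burger x -> has (consumes x) (reduce W)).
Proof.
rewrite reduce_rcons /reduce_step; case: ifP => [bx|nbx].
  by rewrite all_rcons => /andP[_ ->].
case: ifP => [/split_last[R1 [b [R2 [-> xb nR2]]]]|_].
  rewrite del_last_split // !all_cat /= (consumes_burger xb) => /andP[-> ->].
  by split.
by rewrite all_cat /= nbx andbF.
Qed.

Lemma stack_matching_exists W : all is_burger (reduce W) ->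
  exists mu, stack_matching W mu.
Proof.
elim/last_ind: W => [_|W x IHW]; first by exists id; split.
case/reduce_burgers_rcons => /IHW[mu mW] hx.
(* t is the partner of the last letter, and size W + 1 leaves it open *)
have [t [clt nt]] : exists t, (if is_burger x then t = (size W).+1 else
    [/\ t < size W, size W <= mu t, consumes x (nth oF W t) &
     forall a, t < a < size W -> size W <= mu a -> ~~ consumes x (nth oF W a)])
    /\ t != size W.
  case: (boolP (is_burger x)) => [_|/hx]; first by exists (size W).+1; split;
    rewrite // neq_ltn ltnSn orbT.
  rewrite (reduce_stack_matching mW) has_map =>
    /split_last[l1 [t [l2 [e xt nl2]]]].
  exists t; have : t \in open_burgers W mu by rewrite e mem_cat mem_head orbT.
  rewrite mem_filter mem_iota => /and3P[opt _ lt_t]; split;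
    last by rewrite neq_ltn lt_t.
  split=> // a lt_a opa.
  have : a \in open_burgers W mu by rewrite mem_filter mem_iota opa; lia.
  have : sorted ltn (open_burgers W mu) by rewrite sorted_filter
    ?iota_ltn_sorted //; apply: ltn_trans.
  rewrite e (sorted_pairwise ltn_trans) pairwise_cat =>
    /and3P[/allrelP l1l2 _ _].
  rewrite mem_cat in_cons => /or3P[al1|/eqP ea|al2].
  - by have := l1l2 a t al1 (mem_head _ _); rewrite /=; lia.
  - by move: lt_a; rewrite ea; lia.
  - by move/hasPn: nl2; apply.
have [h1 h2 h3 h4 h5] := mW.
set k := size W in clt nt h1 h2 h3 h4 h5 *.
have opt : t < k -> k <= mu t by case: ifP clt => [_ ->|_ []] //; lia.
have bt : t < k -> is_burger (nth oF W t).
  by case: ifP clt => [_ ->|_ [_ _ /consumes_burger]] //; lia.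
(* the value size W of an open burger would now mean a match with x *)
pose nu i := if i == k then t else if i == t then k
             else if mu i < k then mu i else k.+1.
have nuk : nu k = t by rewrite /nu eqxx.
have nut : nu t = k by rewrite /nu eqxx (negbTE nt).
have nucl i : i < k -> mu i < k -> nu i = mu i.
  move=> lt_i cl; rewrite /nu cl; case: eqP => [|_]; first lia.
  by case: eqP => // e; move: opt; rewrite -e; lia.
have nuop i : i < k -> i != t -> k <= mu i -> nu i = k.+1.
  move=> lt_i /negbTE ni op; rewrite /nu ni ltnNge op /=; case: eqP => //; lia.
have nth_lt i : i < k -> nth oF (rcons W x) i = nth oF W i.
  by rewrite nth_rcons => ->.
have nth_k : nth oF (rcons W x) k = x by rewrite nth_rcons ltnn eqxx.
have cases i : i < k.+1 -> [\/ i = k, i < k /\ i = t, i < k /\ mu i < k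
    | [/\ i < k, i != t & k <= mu i]].
  rewrite ltnS leq_eqVlt => /orP[/eqP->|lt_i]; first by constructor 1.
  have [e|ni] := eqVneq i t; first by constructor 2.
  by case: (ltnP (mu i) k) => h; [constructor 3|constructor 4].
exists nu; split; rewrite size_rcons.
- move=> i /cases[->|[_ ->]|[lt_i cl]|[lt_i ni op]]; rewrite ?nuk ?nut //.
  + by rewrite eq_sym.
  + by rewrite nucl ?h1.
  + by rewrite nuop // neq_ltn leqW ?orbT.
- move=> i /cases[->|[_ ->]|[lt_i cl]|[lt_i ni op]]; rewrite ?nuk ?nut //.
  + by rewrite nucl // => _; rewrite nucl ?h2.
  + by rewrite nuop // ltnn.
- move=> i /cases[->|[lt_i e]|[lt_i cl]|[lt_i ni op]].
  + rewrite nuk nth_k; case: ifP clt => // _ [lt_t _ _ _]; lia.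
  + by rewrite nth_lt // e => _; rewrite bt // -e.
  + by rewrite nucl // nth_lt //; apply: h3.
  + by rewrite nth_lt // => _; apply: h3 => //; apply: leq_trans op.
- move=> j /cases[->|[lt_j e]|[lt_j cl]|[lt_j nj op]].
  + rewrite nuk nth_k => lt_t; rewrite nth_lt //.
    by case: ifP clt => [_ e|_ []] //; lia.
  + by rewrite e in lt_j *; rewrite nut; lia.
  + by rewrite nucl // => clj; rewrite !nth_lt //; apply: h4.
  + by rewrite nuop //; lia.
- move=> j a /cases[->|[lt_j e]|[lt_j cl]|[lt_j nj op]].
  + rewrite nuk nth_k => lt_a; rewrite nth_lt => [xa|]; last by case/andP: lt_a.
    case: ifP clt => [_ e|_ [_ _ _ ha]]; first lia.
    have cla : mu a < k by rewrite ltnNge; apply: contraL xa; apply: ha.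
    by rewrite nucl //; case/andP: lt_a.
  + by rewrite e in lt_j *; rewrite nut; lia.
  + rewrite nucl // => lt_a; have lt_ak : a < k by lia.
    rewrite !nth_lt // => ja; have cla := h5 _ _ lt_j lt_a ja.
    by rewrite nucl //; lia.
  + by rewrite nuop //; lia.
Qed.

End Words.

(** * The word of a map and its statistics *)
Section WordOfMap.
Variables (M : rooted_map) (T : {set {set dart M}}).
Hypothesis sT : T \subset edges M.
Notation D := (dart M).
Notation m := (opp M).
Notation S := (tilde T).
Notation X := (symdiff (tilde T) T).
Notation s := (turn_perm (tilde T)).
Notation r := (root M).
Notation posT := (pos s r).
Implicit Types (d x y : D) (A : {set {set D}}).

Let mK := @opp_involutive M.
Let m_neq := @opp_neq M.
Let singS := tilde_single sT.
Let sS : S \subset edges M. Proof. by have [] := tilde_spec sT. Qed.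
Let sX : X \subset edges M.
Proof.
apply/subsetP=> e; rewrite in_symdiff.
case: (boolP (e \in S)) => [/(subsetP sS) //|_].
by case: (boolP (e \in T)) => [/(subsetP sT)|].
Qed.

Let closing := closing_pos m_neq singS.

Definition mate (i : nat) : nat := posT (m (iter i s r)).

Lemma mate_pos d : mate (posT d) = posT (m d).
Proof. by rewrite /mate iter_pos. Qed.

Lemma mate_lt i : mate i < (num_edges M).*2.
Proof. by rewrite -(card_dart sT) pos_lt. Qed.

Lemma size_word : size (word T) = (num_edges M).*2.
Proof. exact: size_mkseq. Qed.

Lemma nth_word d : nth oF (word T) (posT d) = chord_letter T d.
Proof.
rewrite nth_mkseq; last by rewrite -(card_dart sT) pos_lt.
rewrite letterE // -{2}(iter_pos singS d); congr (chord_letter T _).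
by apply: eq_iter => x; rewrite turn_permE.
Qed.

Lemma position_dart i : i < (num_edges M).*2 -> exists d, i = posT d.
Proof.
by rewrite -(card_dart sT) => lt_i; exists (iter i s r); rewrite pos_iter.
Qed.

Lemma burger_letter d : is_burger (chord_letter T d) = (posT d < posT (m d)).
Proof.
rewrite /chord_letter; case: ifP => _; first by case: ifP.
by case: ifP => // _; case: ifP.
Qed.

(** An order of type c or h takes the last burger of its type because chords of
    one type do not cross, an order F the last burger because X is fresh. *)
Lemma stack_matching_word : stack_matching (word T) mate.
Proof.
split=> [i|i|i|j|j a]; rewrite size_word.
- by move=> /position_dart[d ->]; rewrite mate_pos pos_eq.
- by move=> /position_dart[d ->] _; rewrite !mate_pos mK.
- by move=> /position_dart[d ->]; rewrite mate_pos nth_word burger_letter.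
- move=> /position_dart[d ->]; rewrite mate_pos closing !nth_word => ncl.
  rewrite /chord_letter mK closing ncl (negbTE ncl) /edge_of porbit_image.
  by case: ifP => _; case: ifP.
move=> lt_j; have [d ->] := position_dart lt_j; rewrite mate_pos => lt_a.
have /position_dart[x ea] : a < (num_edges M).*2.
  by rewrite -(card_dart sT); apply: leq_trans (ltnW (pos_lt singS d)); lia.
rewrite {a}ea in lt_a *; rewrite mate_pos !nth_word => dx.
have := consumes_burger dx; rewrite burger_letter => opx.
have clX : edge_of d \in X -> posT (m x) < posT d.
  move=> dX; have := tilde_fresh sT => frX.
  have := frX (m d) x; rewrite porbit_image mK; apply=> //.
have ncr A : noncrossing m s r A -> edge_of d \in A -> edge_of x \in A ->
    posT (m x) < posT d.
  move=> ncA dA xA; have := ncA (m d) x; rewrite porbit_image mK.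
  by move=> /(_ dA xA lt_a)/andP[].
have := dx; rewrite /chord_letter opx; case: ifP => [opd|_]; first by case: ifP.
have [/clX //|_] := boolP (edge_of d \in X).
have [dS|ndS] := boolP (edge_of d \in S).
  by case: ifP => // xS _; apply: (ncr S) => //; apply: tilde_noncrossing.
case: ifP => // /negbT nxS _; apply: (ncr (dual_edges S)).
- exact: tilde_dual_noncrossing.
- by rewrite inE ndS mem_edges.
- by rewrite inE nxS mem_edges.
Qed.

Lemma reduce_word : reduce (word T) = [::].
Proof.
rewrite (reduce_stack_matching stack_matching_word) /open_burgers.
rewrite (@eq_filter _ _ pred0) ?filter_pred0 // => i.
by rewrite size_word leqNgt mate_lt.
Qed.

Lemma count_word a : count a (word T) = #|[set d | a (chord_letter T d)]|.
Proof.
transitivity #|[set i : 'I_((num_edges M).*2) | a (nth oF (word T) i)]|.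
  rewrite -[in LHS](mkseq_nth oF (word T)) size_word /mkseq count_map.
  rewrite -val_enum_ord count_map cardE enumT.
  rewrite [in RHS]/(enum _) size_filter; apply: eq_count => i;
    by rewrite /= inE.
rewrite (card_positions singS (fun i => a (nth oF (word T) i))).
  by apply: eq_card => d; rewrite !inE nth_word.
by rewrite (card_dart sT).
Qed.

Lemma num_matches_word b o : ~~ is_burger o -> num_matches b o (word T) =
  #|[set d | (chord_letter T d == o) && (chord_letter T (m d) == b)]|.
Proof.
move=> no; rewrite /num_matches.
rewrite (card_positions singS (fun i => (nth oF (word T) i == o) &&
  (deleted (reduce (take i (word T))) o == Some b))); last first.
  by rewrite size_word (card_dart sT).
apply: eq_card => d; rewrite !inE nth_word.
case: eqP => //= eo; rewrite -eo -nth_word.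
rewrite (deleted_stack_matching stack_matching_word).
- by rewrite mate_pos nth_word.
- by rewrite size_word -(card_dart sT) pos_lt.
- by rewrite mate_pos closing -burger_letter eo.
Qed.

(** Each edge has exactly one closing dart. *)
Lemma card_matched A b o : A \subset edges M ->
    (forall d, ~~ (posT d < posT (m d)) -> (edge_of d \in A) =
      (chord_letter T d == o) && (chord_letter T (m d) == b)) ->
  ~~ is_burger o -> num_matches b o (word T) = #|A|.
Proof.
move=> sA hA no; rewrite num_matches_word // -(card_closes mK m_neq singS sA).
apply: eq_card => d; rewrite !inE closing.
have [opd|cld] := boolP (posT d < posT (m d)); last by rewrite andbT -hA.
rewrite andbF; apply/negP=> /andP[/eqP e _].
by rewrite -burger_letter e (negbTE no) in opd.
Qed.

Lemma letters_closing d : ~~ (posT d < posT (m d)) ->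
  chord_letter T d =
    (if edge_of d \in X then oF else if edge_of d \in S then oh else oc)
  /\ chord_letter T (m d) = (if edge_of d \in S then bH else bC).
Proof.
move=> cld; rewrite /chord_letter mK closing cld (negbTE cld).
by rewrite /edge_of porbit_image.
Qed.

Lemma num_matches_HF : num_matches bH oF (word T) = #|S :&: X|.
Proof.
apply: card_matched => // [|d /letters_closing[-> ->]].
  exact: subset_trans (subsetIl _ _) sS.
by rewrite inE; case: (_ \in S); case: (_ \in X).
Qed.

Lemma num_matches_CF : num_matches bC oF (word T) = #|dual_edges S :&: X|.
Proof.
apply: card_matched => // [|d /letters_closing[-> ->]].
  exact: subset_trans (subsetIr _ _) sX.
by rewrite in_setI in_setD mem_edges; case: (_ \in S); case: (_ \in X).
Qed.

Lemma num_matches_Hh : num_matches bH oh (word T) = #|S :\: X|.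
Proof.
apply: card_matched => // [|d /letters_closing[-> ->]].
  exact: subset_trans (subsetDl _ _) sS.
by rewrite inE; case: (_ \in S); case: (_ \in X).
Qed.

Lemma num_matches_Cc : num_matches bC oc (word T) = #|dual_edges S :\: X|.
Proof.
apply: card_matched => // [|d /letters_closing[-> ->]].
  exact: subset_trans (subsetDl _ _) (subsetDl _ _).
by rewrite in_setD [in X in _ && X]in_setD mem_edges andbT; case: (_ \in S);
  case: (_ \in X).
Qed.

Lemma card_tilde_word : #|S| = count_mem bH (word T).
Proof.
rewrite count_word -(card_opens mK m_neq singS sS); apply: eq_card => d.
rewrite [LHS]inE [RHS]inE /= /chord_letter -/(edge_of d).
by case: (posT d < _); case: (edge_of d \in S); case: (edge_of d \in X).
Qed.

Lemma card_dual_tilde_word : #|dual_edges S| = count_mem bC (word T).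
Proof.
have sS' : dual_edges S \subset edges M by apply: subsetDl.
rewrite count_word -(card_opens mK m_neq singS sS'); apply: eq_card => d.
rewrite [LHS]inE [RHS]inE /= /chord_letter -/(edge_of d) in_setD mem_edges
  andbT.
by case: (posT d < _); case: (edge_of d \in S); case: (edge_of d \in X).
Qed.

Lemma turn_perm_fictional : turn_perm T = (toggle_perm m X * s)%g.
Proof. by rewrite -turn_perm_symdiff symdiffK. Qed.

Lemma num_loops_word : num_loops T = 1 + count_mem oF (word T).
Proof.
have ncX := fresh_noncrossing mK singS (tilde_fresh sT).
have -> : num_loops T = #|porbits (turn_perm T)|.
  congr #|pred_of_set _|; apply: eq_imset => d; apply/setP=> x; exact: in_loop.
rewrite turn_perm_fictional (card_porbits_noncrossing mK singS ncX) add1n;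
  congr _.+1.
rewrite card_opens // -(card_closes mK m_neq singS sX) count_word.
apply: eq_card => d; rewrite [LHS]inE [RHS]inE closing /= /chord_letter
  -/(edge_of d).
by case: (posT d < _); case: (edge_of d \in S); case: (edge_of d \in X).
Qed.

Lemma num_comps_word : num_comps (cw M) T = 1 + num_matches bH oF (word T).
Proof.
have := n_comp_noncrossing mK singS (tilde_noncrossing sT) (porbit_cw T)
  (tilde_fresh sT).
rewrite symdiffK num_matches_HF add1n card_opens //.
exact: subset_trans (subsetIl _ _) sS.
Qed.

Lemma num_dual_comps_word :
  num_comps (fnext M) (dual_edges T) = 1 + num_matches bC oF (word T).
Proof.
have := n_comp_noncrossing mK singS (tilde_dual_noncrossing sT) (porbit_fnext T)
  (tilde_fresh sT).
have -> : symdiff (dual_edges S) X = dual_edges T.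
  apply/setP=> e; rewrite !in_symdiff !in_setD.
  move: (subsetP sS e) (subsetP sT e).
  by case: (e \in S); case: (e \in T); case: (e \in edges M) => // h h';
    first [have := h isT | have := h' isT].
rewrite num_matches_CF add1n card_opens //.
exact: subset_trans (subsetIr _ _) sX.
Qed.

Lemma card_edges_word : #|T| =
  num_matches bH oh (word T) + num_matches bC oF (word T).
Proof.
rewrite num_matches_Hh num_matches_CF -(cardsID S T); congr (_ + _);
  apply: eq_card => e; rewrite !(in_setI, in_setD, in_symdiff).
  by case: (e \in S); case: (e \in T).
move: (subsetP sT e).
by case: (e \in S); case: (e \in T); case: (e \in edges M) => // h;
  have := h isT.
Qed.

Lemma card_dual_edges_word :
  #|dual_edges T| = num_matches bC oc (word T) + num_matches bH oF (word T).
Proof.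
rewrite num_matches_Cc num_matches_HF -(cardsID S (dual_edges T)) addnC.
congr (_ + _); apply: eq_card => e; rewrite !(in_setI, in_setD, in_symdiff).
  by case: (e \in S); case: (e \in T); case: (e \in edges M).
move: (subsetP sS e).
by case: (e \in S); case: (e \in T); case: (e \in edges M) => // h;
  have := h isT.
Qed.

End WordOfMap.

(** * Invariance and injectivity *)
Section Isomorphism.
Variables (M1 M2 : rooted_map) (f : dart M1 -> dart M2).
Hypothesis f_inj : injective f.
Hypothesis f_opp : forall d, f (opp M1 d) = opp M2 (f d).

Definition image_edges (A : {set {set dart M1}}) : {set {set dart M2}} :=
  [set f @: e | e : {set dart M1} in A].

Lemma edge_of_image d : f @: edge_of d = edge_of (f d).
Proof.
apply/setP=> x; rewrite -eq_porbit_mem porbit_involution;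
  last exact: opp_involutive.
apply/imsetP/orP => [[y yd ->]|[]/eqP->].
- move: yd; rewrite -eq_porbit_mem porbit_involution;
    last exact: opp_involutive.
  by case/orP=> /eqP->; [left|right; rewrite f_opp].
- by exists d; rewrite // porbit_id.
- by exists (opp M1 d); rewrite // -eq_porbit_mem porbit_image.
Qed.

Lemma mem_image_edges A d :
  (edge_of (f d) \in image_edges A) = (edge_of d \in A).
Proof.
by rewrite -edge_of_image /image_edges mem_imset //; apply: imset_inj.
Qed.

Lemma image_toggle A d :
  f (toggle (opp M1) A d) = toggle (opp M2) (image_edges A) (f d).
Proof.
rewrite /toggle -!/(edge_of _) mem_image_edges.
by case: ifP.
Qed.

Lemma eq_image_edges (A : {set {set dart M1}}) (B : {set {set dart M2}}) :
    (forall y, exists d, y = f d) -> A \subset edges M1 -> B \subset edges M2 ->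
    (forall d, (edge_of (f d) \in B) = (edge_of d \in A)) ->
  B = image_edges A.
Proof.
move=> f_surj sA sB AB; apply/setP=> e; apply/idP/imsetP => [eB|[e' e'A ->]].
  have /imsetP[y _ ey] := subsetP sB e eB; have [d ed] := f_surj y.
  by exists (edge_of d); rewrite ?edge_of_image -?ed // -AB -ed /edge_of -ey.
have /imsetP[d _ ed] := subsetP sA e' e'A.
by rewrite ed (edge_of_image d) AB /edge_of -ed.
Qed.

End Isomorphism.

(** The image of tilde T1 has a single loop and a fresh difference with T2,
    hence it is tilde T2; letters depend on the chord diagram only. *)
Lemma same_map_word (M1 M2 : rooted_map)
    (T1 : {set {set dart M1}}) (T2 : {set {set dart M2}}) :
    num_edges M1 = num_edges M2 -> T1 \subset edges M1 -> T2 \subset edges M2 ->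
  same_map T1 T2 -> word T1 = word T2.
Proof.
move=> eN sT1 sT2 [f [f_bij [f_cw [f_opp [f_root eT2]]]]].
have f_inj := bij_inj f_bij; have [g fK gK] := f_bij.
have f_surj y : exists d, y = f d by exists (g y).
have [sS1 singS1 frS1] := tilde_spec sT1.
pose S2 := image_edges f (tilde T1).
have mS2 d : (edge_of (f d) \in S2) = (edge_of d \in tilde T1).
  exact: mem_image_edges.
have mT2 d : (edge_of (f d) \in T2) = (edge_of d \in T1).
  by rewrite eT2; apply: mem_image_edges.
have f_cwV d : f ((cw M1)^-1%g d) = (cw M2)^-1%g (f d).
  by apply: (@perm_inj _ (cw M2)); rewrite permKV -f_cw permKV.
have f_turn d : f (turn_perm (tilde T1) d) = turn_perm S2 (f d).
  by rewrite !toggle_permE f_cwV (image_toggle f_inj f_opp).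
have f_iter k : f (iter k (turn_perm (tilde T1)) (root M1)) =
    iter k (turn_perm S2) (root M2).
  by elim: k => //= k IHk; rewrite f_turn IHk.
have singS2 : single S2.
  move=> y; have [d ->] := f_surj y; rewrite -(iter_pos singS1 d) f_iter.
  by rewrite porbit_fconnect fconnect_iter.
have pos2 d : pos (turn_perm S2) (root M2) (f d) =
    pos (turn_perm (tilde T1)) (root M1) d.
  rewrite -{1}(iter_pos singS1 d) f_iter pos_iter //.
  by rewrite -(bij_eq_card f_bij) pos_lt.
have sS2 : S2 \subset edges M2.
  apply/subsetP=> _ /imsetP[e eS ->]; have /imsetP[d _ ->] := subsetP sS1 e eS.
  by rewrite (edge_of_image f_opp d) mem_edges.
have eS2 : tilde T2 = S2.
  apply: tilde_unique => // x2 y2; have [x ->] := f_surj x2;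
    have [y ->] := f_surj y2.
  rewrite -f_opp -f_opp !pos2 in_symdiff -/(edge_of (f x)) mS2 mT2 -in_symdiff.
  exact: frS1.
apply: (@eq_from_nth _ oF) => [|i]; rewrite !size_word ?eN // => lt_i.
rewrite -eN in lt_i; have [d ->] := position_dart sT1 lt_i; rewrite nth_word //.
rewrite -pos2 -eS2 nth_word //.
by rewrite /chord_letter eS2 -f_opp !pos2 !in_symdiff mS2 mT2.
Qed.

(** Two maps with the same word: their darts correspond by position, and the
    edges and the sets S and X are recovered from the word. *)
Section Reconstruction.
Variables (M1 M2 : rooted_map).
Variables (T1 : {set {set dart M1}}) (T2 : {set {set dart M2}}).
Hypotheses (sT1 : T1 \subset edges M1) (sT2 : T2 \subset edges M2).
Hypothesis eN : num_edges M1 = num_edges M2.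
Hypothesis eW : word T1 = word T2.
Notation s1 := (turn_perm (tilde T1)).
Notation s2 := (turn_perm (tilde T2)).
Notation pos1 := (pos s1 (root M1)).
Notation pos2 := (pos s2 (root M2)).

Let sing1 := tilde_single sT1.
Let sing2 := tilde_single sT2.

Let f d := iter (pos1 d) s2 (root M2).

Let pos2_f d : pos2 (f d) = pos1 d.
Proof. by rewrite pos_iter // (card_dart sT2) -eN -(card_dart sT1) pos_lt. Qed.

Let f_bij : bijective f.
Proof.
exists (fun y => iter (pos2 y) s1 (root M1)) => d.
  by rewrite pos2_f iter_pos.
rewrite /f pos_iter ?iter_pos //.
by rewrite (card_dart sT1) eN -(card_dart sT2) pos_lt.
Qed.

Let mate_eq d : mate T1 (pos1 d) = mate T2 (pos1 d).
Proof.
apply: (stack_matching_unique (stack_matching_word sT1)).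
- by rewrite eW; apply: stack_matching_word.
- by move=> i _; rewrite size_word mate_lt.
- by move=> i _; rewrite eW size_word mate_lt.
- by rewrite size_word -(card_dart sT1) pos_lt.
Qed.

Let f_opp d : f (opp M1 d) = opp M2 (f d).
Proof.
apply: (pos_inj sing2); rewrite pos2_f -(mate_pos sT1) mate_eq -pos2_f.
exact: mate_pos.
Qed.

Let f_turn d : f (s1 d) = s2 (f d).
Proof.
apply: (pos_inj sing2); rewrite pos2_f !pos_succ_mod // pos2_f.
by rewrite (card_dart sT1) (card_dart sT2) eN.
Qed.

Let f_letter d : chord_letter T2 (f d) = chord_letter T1 d.
Proof. by rewrite -nth_word // pos2_f -eW nth_word. Qed.

Let mem_tilde (M : rooted_map) (T : {set {set dart M}}) d :
  T \subset edges M ->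
  (edge_of d \in tilde T) =
  ((chord_letter T d == bH) || (chord_letter T (opp M d) == bH)).
Proof.
move=> sT; rewrite /chord_letter opp_involutive /edge_of porbit_image.
rewrite (closing_pos (@opp_neq M) (tilde_single sT)).
by case: (_ < _); case: (_ \in tilde T); case: (_ \in symdiff _ _).
Qed.

Let mem_fictional (M : rooted_map) (T : {set {set dart M}}) d :
  T \subset edges M ->
  (edge_of d \in symdiff (tilde T) T) =
  ((chord_letter T d == oF) || (chord_letter T (opp M d) == oF)).
Proof.
move=> sT; rewrite /chord_letter opp_involutive /edge_of porbit_image.
rewrite (closing_pos (@opp_neq M) (tilde_single sT)).
by case: (_ < _); case: (_ \in tilde T); case: (_ \in symdiff _ _).
Qed.

Lemma word_inj : same_map T1 T2.
Proof.
have f_inj := bij_inj f_bij; have [g fK gK] := f_bij.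
have f_surj y : exists d, y = f d by exists (g y).
have fS d : (edge_of (f d) \in tilde T2) = (edge_of d \in tilde T1).
  by rewrite !mem_tilde // -f_opp !f_letter.
have fX d : (edge_of (f d) \in symdiff (tilde T2) T2) =
    (edge_of d \in symdiff (tilde T1) T1).
  by rewrite !mem_fictional // -f_opp !f_letter.
have fT d : (edge_of (f d) \in T2) = (edge_of d \in T1).
  rewrite -(symdiffK (tilde T2) T2) -(symdiffK (tilde T1) T1).
  by rewrite !(in_symdiff (tilde _) (symdiff _ _)) fS fX.
exists f; split; first exact: f_bij.
split=> [d|]; last first.
  split=> //; split; first by rewrite /f pos_root.
  exact: (eq_image_edges f_opp f_surj sT1 sT2 fT).
have [sS1 _ _] := tilde_spec sT1; have [sS2 _ _] := tilde_spec sT2.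
have cwV M (S : {set {set dart M}}) x : (cw M)^-1%g x =
  turn_perm S (toggle (opp M) S x).
  by rewrite -toggle_permE toggle_turn_cw.
apply: (@perm_inj _ (cw M2)^-1%g); rewrite permK.
rewrite (cwV _ (tilde T2)) (eq_image_edges f_opp f_surj sS1 sS2 fS).
rewrite -(image_toggle f_inj f_opp) -(eq_image_edges f_opp f_surj sS1 sS2 fS).
by rewrite -f_turn -cwV permK.
Qed.

End Reconstruction.

(** * Surjectivity *)
Section ChordMap.
Variables (D : finType) (m s : {perm D}) (r : D).
Hypothesis mK : forall d, m (m d) = d.
Hypothesis m_neq : forall d, m d != d.
Hypothesis s_single : forall d, d \in porbit s r.
Variable S : {set {set D}}.
Hypothesis sS : S \subset porbits m.
Hypothesis ncS : noncrossing m s r S.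
Hypothesis ncS' : noncrossing m s r (porbits m :\: S).

Let cwV : {perm D} := (toggle_perm m S * s)%g.

(** One step back along s is a turn around a vertex, possibly followed by the
    passage to the other dart of an edge. *)
Let chord_connected x y :
  connect [rel a b | (b == cwV^-1%g a) || (b == m a)] x y.
Proof.
set e := rel_of_simpl _.
have back d : connect e (s d) d.
  have e1 : cwV^-1%g (s d) = toggle m S d.
    apply: (@perm_inj _ cwV); rewrite permKV toggle_permE toggle_symdiff //.
    by rewrite /toggle in_symdiff eqxx.
  apply: connect_trans (_ : connect e (toggle m S d) d).
    by apply: connect1; rewrite /e /= e1 eqxx.
  rewrite /toggle; case: ifP => _; last exact: connect0.
  by apply: connect1; rewrite /e /= mK eqxx orbT.
have : x \in porbit s y.
  by have := s_single x; rewrite -!eq_porbit_mem (eqP (_ : porbit s y == porbit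
    s r)) // eq_porbit_mem.
case/porbitP=> i ->; rewrite permX; elim: i => [|i IHi]; first exact: connect0.
exact: connect_trans (back _) IHi.
Qed.

(** The vertices and the faces are the regions cut out by the two noncrossing
    sets of chords. *)
Let chord_euler :
  #|porbits cwV^-1| + #|porbits (m * cwV^-1^-1)%g| = #|porbits m| + 2.
Proof.
have -> : (m * cwV^-1^-1)%g = (toggle_perm m (porbits m :\: S) * s)%g.
  rewrite invgK /cwV mulgA; congr (_ * _)%g; apply/permP=> d.
  rewrite permM !permE /toggle porbit_image inE imset_f // andbT.
  by case: (_ \in S); rewrite //= mK.
rewrite porbitsV !(card_porbits_noncrossing mK s_single) // !(card_opens mK
  m_neq s_single) //.
  by rewrite -(cardsID S (porbits m)) (setIidPr sS) addSn addnS addn2.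
exact: subsetDl.
Qed.

Definition chord_map : rooted_map :=
  @RootedMap D (cwV^-1)%g m r mK m_neq chord_connected chord_euler.

Lemma chord_map_turn : turn_perm (M := chord_map) S = s.
Proof.
rewrite /turn_perm /= invgK /cwV mulgA -[RHS]mul1g; congr (_ * _)%g.
apply/permP=> d; rewrite permM !permE toggle_symdiff //.
by rewrite /toggle in_symdiff eqxx.
Qed.

Lemma chord_map_tilde (X : {set {set D}}) :
    X \subset porbits m -> fresh m s r X ->
  tilde (M := chord_map) (symdiff S X) = S.
Proof.
move=> sX frX; have single_S : single (M := chord_map) S.
  by move=> d; rewrite chord_map_turn.
apply: tilde_unique => //; last by rewrite symdiffK chord_map_turn.
apply/subsetP=> e; rewrite in_symdiff.
case: (boolP (e \in S)) => [/(subsetP sS) //|_].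
by case: (boolP (e \in X)) => [/(subsetP sX)|].
Qed.

End ChordMap.

(** The chord diagram of a complete matching of W, drawn on the positions. *)
Section WordMap.
Variables (n : nat) (W : seq symbol) (mu : nat -> nat).
Hypothesis n_gt0 : 0 < n.
Hypothesis sizeW : size W = n.*2.
Hypothesis mW : stack_matching W mu.
Hypothesis mu_lt : forall i, i < size W -> mu i < size W.

Let N := n.*2.
Let D := 'I_N.

Let mu_ltN (i : D) : mu i < N.
Proof. by have := @mu_lt i; rewrite sizeW => /(_ (ltn_ord i)). Qed.

Let mate_ord (i : D) : D := Ordinal (mu_ltN i).

Let ltW (i : D) : i < size W. Proof. by rewrite sizeW. Qed.

Let mate_ordK : involutive mate_ord.
Proof.
by move=> i; apply: val_inj => /=; case: mW => _ h2 _ _ _; rewrite h2 // mu_lt.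
Qed.

Let m : {perm D} := perm (inv_inj mate_ordK).
Let s : {perm D} := perm (@ordS_inj N).
Let N_gt0 : 0 < N. Proof. by rewrite /N double_gt0. Qed.
Let r : D := Ordinal N_gt0.

Let m_val i : m i = mu i :> nat. Proof. by rewrite permE. Qed.

Let mK i : m (m i) = i.
Proof. by rewrite !permE mate_ordK. Qed.

Let m_neq i : m i != i.
Proof. by rewrite -val_eqE /= m_val; case: mW => h1 _ _ _ _; rewrite h1. Qed.

Let iter_s k : k < N -> iter k s r = k :> nat.
Proof.
elim: k => // k IHk lt_k; rewrite iterS permE /= IHk ?modn_small //.
exact: ltnW.
Qed.

Let s_single d : d \in porbit s r.
Proof.
rewrite porbit_fconnect -(_ : iter d s r = d) ?fconnect_iter //.
by apply: val_inj; rewrite /= iter_s.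
Qed.

Let pos_val (d : D) : pos s r d = d.
Proof.
rewrite -{1}(_ : iter d s r = d) ?pos_iter ?card_ord //.
by apply: val_inj; rewrite /= iter_s.
Qed.

(** Edges selected by a property of their opening positions. *)
Let chords (P : D -> bool) : {set {set D}} :=
  [set porbit m i | i : D in [pred i : D | (i < m i) && P i]].

Let mem_chords P (i : D) : i < m i -> (porbit m i \in chords P) = P i.
Proof.
move=> op; apply/imsetP/idP => [[j /andP[opj Pj] /eqP]|Pi]; last first.
  by exists i; rewrite ?inE // op Pi.
rewrite porbit_involution // => /orP[/eqP->//|/eqP e].
by move: op opj; rewrite e mK; lia.
Qed.

Let sub_chords P : chords P \subset porbits m.
Proof. by apply/subsetP=> _ /imsetP[i _ ->]; apply: imset_f. Qed.

Let S := chords (fun i => nth oF W i == bH).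
Let X := chords (fun i => nth oF W (m i) == oF).

Let burger (i : D) : i < m i -> is_burger (nth oF W i).
Proof. by rewrite m_val; case: mW => _ _ h3 _ _; apply: h3. Qed.

Let eaten (i : D) : i < m i -> consumes (nth oF W (m i)) (nth oF W i).
Proof.
move=> op; case: mW => _ _ _ h4 _; have := h4 (m i) (ltW _).
by rewrite -!m_val mK; apply.
Qed.

Let last_eaten (i j : D) :
  i < j < m i -> consumes (nth oF W (m i)) (nth oF W j) -> m j < m i.
Proof.
move=> lt_j c; case: mW => _ _ _ _ h5; have := h5 (m i) j (ltW _).
by rewrite -!m_val mK; apply.
Qed.

Let chords_case P (i : D) : porbit m i \in chords P ->
  (i < m i) && P i \/ (m i < i) && P (m i).
Proof.
case/imsetP=> j /andP[opj Pj] /eqP; rewrite porbit_involution //.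
by case/orP=> /eqP->; [left|right; rewrite mK]; rewrite opj.
Qed.

Let frX : fresh m s r X.
Proof.
move=> i j /chords_case iX; rewrite !pos_val => lt_j.
case: iX => [/andP[opi /eqP eF]|/andP[]]; last by lia.
have [opj|clj] := ltnP j (m j); last by lia.
by apply: last_eaten => //; rewrite eF /=; apply: burger.
Qed.

Let same_type_noncrossing (P : pred symbol) (A : {set {set D}}) :
    (forall i : D, i < m i -> (porbit m i \in A) = P (nth oF W i)) ->
    (forall o b b', P b -> P b' -> is_burger b' ->
       consumes o b -> consumes o b') ->
  noncrossing m s r A.
Proof.
move=> AP PP.
have main (i j : D) : porbit m i \in A -> porbit m j \in A -> i < j < m i ->
  j < m j ->
    m j < m i.
  move=> iA jA lt_j opj; have opi : i < m i by lia.
  apply: last_eaten => //; apply: (PP _ (nth oF W i)); rewrite -?AP //.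
  - exact: burger.
  - exact: eaten.
move=> i j iA jA; rewrite !pos_val => lt_j.
have [opj|clj] := ltnP j (m j).
  by have := main i j iA jA lt_j opj; lia.
have nj : m j != j :> nat by rewrite val_eqE m_neq.
have ni : m j != i :> nat.
  rewrite val_eqE; apply: contraTneq lt_j => e; rewrite -e mK ltnn.
  by rewrite andbF.
rewrite -[j in m j]mK; have := main (m j) i; rewrite porbit_image mK => h.
by have := h jA iA; lia.
Qed.

Lemma word_map_exists : exists (M : rooted_map) (T : {set {set dart M}}),
  num_edges M = n /\ T \subset edges M /\ word T = W.
Proof.
have ncS : noncrossing m s r S.
  apply: (@same_type_noncrossing (pred1 bH)) => [i|]; first exact: mem_chords.
  by move=> o b b' /eqP-> /eqP->.
have ncS' : noncrossing m s r (porbits m :\: S).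
  apply: (@same_type_noncrossing (predC1 bH)) => [i op|].
    by rewrite inE mem_chords // imset_f // andbT.
  by case; case; case.
pose M := chord_map mK m_neq s_single (sub_chords _) ncS ncS'.
pose T : {set {set dart M}} := symdiff S X.
have eT : tilde T = S.
  exact: (chord_map_tilde mK m_neq s_single (sub_chords _) ncS ncS'
    (sub_chords _) frX).
have sT : T \subset edges M.
  apply/subsetP=> e; rewrite in_symdiff.
  case: (boolP (e \in S)) => [/(subsetP (sub_chords _)) //|_].
  by case: (boolP (e \in X)) => [/(subsetP (sub_chords _))|].
have eN : num_edges M = n.
  by apply: double_inj; rewrite -(card_dart sT) card_ord.
exists M, T; split=> //; split=> //.
apply: (@eq_from_nth _ oF) => [|i]; rewrite size_word eN ?sizeW // => lt_i.
pose d : D := Ordinal lt_i.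
have es : turn_perm (tilde T) = s by rewrite eT; apply: chord_map_turn.
have -> : i = pos (turn_perm (tilde T)) (root M) d by rewrite es pos_val.
rewrite nth_word // es pos_val /chord_letter es eT symdiffK !pos_val.
have -> : opp M d = m d by [].
have -> : edge_of (d : dart M) = porbit m d by [].
have [op|] := ltnP d (m d).
  by rewrite mem_chords //; have := burger op; case: (nth _ _ _).
rewrite leq_eqVlt val_eqE (negbTE (m_neq d)) /= => cl.
have op : m d < m (m d) by rewrite mK.
rewrite -(porbit_image m d) !mem_chords // mK.
by have := eaten op; rewrite mK; case: (nth _ _ d); case: (nth _ _ (m d)).
Qed.

End WordMap.

Theorem mainTheorem2 (n : nat) (n_ge1 : 1 <= n) :
  (* the words obtained lie in the target set *)
  (forall (M : rooted_map) (T : {set {set dart M}}),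
     num_edges M = n -> T \subset edges M ->
     size (word T) = n.*2 /\ reduce (word T) = [::])
  (* the word is well defined up to deformation, and injective *)
  /\ (forall (M1 : rooted_map) (T1 : {set {set dart M1}})
        (M2 : rooted_map) (T2 : {set {set dart M2}}),
        num_edges M1 = n -> T1 \subset edges M1 ->
        num_edges M2 = n -> T2 \subset edges M2 ->
        word T1 = word T2 <-> same_map T1 T2)
  (* surjectivity *)
  /\ (forall W : seq symbol, size W = n.*2 -> reduce W = [::] ->
        exists (M : rooted_map) (T : {set {set dart M}}),
          num_edges M = n /\ T \subset edges M /\ word T = W)
  (* the statistics *)
  /\ (forall (M : rooted_map) (T : {set {set dart M}}),
        num_edges M = n -> T \subset edges M ->
        let W := word T in
        #|tilde T| = count_mem bH W
        /\ #|dual_edges (tilde T)| = count_mem bC W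
        /\ num_loops T = 1 + count_mem oF W
        /\ num_comps (cw M) T = 1 + num_matches bH oF W
        /\ num_comps (fnext M) (dual_edges T) = 1 + num_matches bC oF W
        /\ #|T| = num_matches bH oh W + num_matches bC oF W
        /\ #|dual_edges T| = num_matches bC oc W + num_matches bH oF W).
Proof.
split=> [M T eM sT|].
  by rewrite size_word eM reduce_word.
split=> [M1 T1 M2 T2 e1 sT1 e2 sT2|].
  have eN : num_edges M1 = num_edges M2 by rewrite e1 e2.
  by split=> [|/same_map_word]; [apply: word_inj|apply].
split=> [W sW rW|M T eM sT W].
  have [|mu mW] := @stack_matching_exists W; first by rewrite rW.
  apply: (@word_map_exists n W mu) => // i lt_i; rewrite ltnNge;
    apply/negP=> op.
  have := reduce_stack_matching mW; rewrite rW => /(congr1 size)/esym/eqP.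
  rewrite size_map size_filter -leqn0 leqNgt -has_count => /hasP[].
  by exists i; rewrite ?mem_iota.
do !split; rewrite /W.
- exact: card_tilde_word.
- exact: card_dual_tilde_word.
- exact: num_loops_word.
- exact: num_comps_word.
- exact: num_dual_comps_word.
- exact: card_edges_word.
- exact: card_dual_edges_word.
Qed.
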